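(* Let $m\ge 2$ and let $A:\mathbb{R}\to\mathbb{C}^{m\times m}$ be continuous with a full asymptotic expansion $A(\rho)\sim A_0+\rho A_1+\rho^2A_2+\cdots$ as $\rho\to0$. Let $n\in\{0,1,2,\ldots\}$ and assume that $A(\rho)$ is non-degenerate of order $n$ in $\rho=0$ (defined in the context). Then there exist, for $\rho$ in a neighbourhood of $0$, a uniformly bounded family of invertible matrices $M(\rho)\in\mathbb{C}^{m\times m}$ with uniformly bounded inverse, having a full asymptotic expansion as $\rho\to0$, and diagonal matrices $\Lambda(\rho)$, such that $$A(\rho)M(\rho)-M(\rho)\Lambda(\rho)=\mathcal{O}(\rho^N)\quad\text{as }\rho\to0,\qquad\text{for all } N.$$ Furthermore, at least two eigenvalues of $A(\rho)$ coincide modulo $\mathcal{O}(\rho^n)$ in $\rho=0$; that is, the eigenvalues of $A(\rho)$ near $\rho=0$ (counted with multiplicity) can be labelled as continuous functions $\lambda_1(\rho),\ldots,\lambda_m(\rho)$ in such a way that $\lambda_i(\rho)-\lambda_j(\rho)=\mathcal{O}(\rho^n)$ as $\rho\to0$ for some $i\neq j$.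
   Context: A matrix-valued function $F(\rho)$ has the full asymptotic expansion $F(\rho)\sim\sum_{k\ge0}\rho^kF_k$ as $\rho\to0$ if for every $N$ one has $F(\rho)=\sum_{k=0}^N\rho^kF_k+\mathcal{O}(\rho^{N+1})$. ''Diagonable'' means diagonalisable over $\mathbb{C}$; a diagonaliser of a matrix $X$ is an invertible $T$ with $T^{-1}XT$ diagonal. $[X,Y]=XY-YX$. For an equivalence relation $\sim_\Pi$ on $\{1,\dots,m\}$ (a partition $\Pi$), $\mathrm{b\text{-}diag}_\Pi X$ is the matrix with entries $X_{ij}$ if $i\sim_\Pi j$ and $0$ otherwise; a matrix $X$ is $\Pi$-block-diagonal if $X=\mathrm{b\text{-}diag}_\Pi X$. Multi-step diagonalisation scheme. Let $\Pi_{-1}$ be the trivial partition with one class. Step 0. Set $\tilde\Lambda_0=A_0$. If $\tilde\Lambda_0$ is diagonable, choose a diagonaliser $M_0$ with $M_0^{-1}A_0M_0=\Lambda_0=\mathrm{diag}(\lambda^{[0]}_1,\dots,\lambda^{[0]}_m)$, equal eigenvalues being in consecutive positions. Put $i\sim_{\Pi_0}j$ iff $\lambda_i^{[0]}=\lambda_j^{[0]}$, and $\tilde A^{[0]}(\rho)=M_0^{-1}A(\rho)M_0$. Step $k+1$ ($k\ge0$). Suppose that $\tilde A^{[k]}(\rho)\sim\Lambda_0+\rho\Lambda_1+\cdots+\rho^k\Lambda_k+\rho^{k+1}\tilde A^{[k]}_{k+1}+\cdots$ has been constructed, with diagonal $\Lambda_{k'}=\mathrm{diag}(\lambda_1^{[k']},\dots,\lambda_m^{[k']})$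 and with partitions given by $i\sim_{\Pi_\ell}j$ iff $\lambda_i^{[k']}=\lambda_j^{[k']}$ for all $k'\le \ell$ ($\ell\le k$). Let $A^{[k,0]}_{k+1}=\mathrm{b\text{-}diag}_{\Pi_0}\tilde A^{[k]}_{k+1}$ and let $K^{[k]}_0$ solve $[\Lambda_0,K^{[k]}_0]+\tilde A^{[k]}_{k+1}-A^{[k,0]}_{k+1}=0$. For $\ell=1,\dots,k$ let $A^{[k,\ell]}_{k+1}=\mathrm{b\text{-}diag}_{\Pi_\ell}A^{[k,\ell-1]}_{k+1}$ and let $K^{[k]}_\ell$ be a $\Pi_{\ell-1}$-block-diagonal solution of $[\Lambda_\ell,K^{[k]}_\ell]+A^{[k,\ell-1]}_{k+1}-A^{[k,\ell]}_{k+1}=0$. (For definiteness each $K^{[k]}_\ell$ is taken with zero $(i,j)$ entries whenever $i\sim_{\Pi_\ell}j$.) Set $\tilde\Lambda_{k+1}=A^{[k,k]}_{k+1}$, which is $\Pi_k$-block-diagonal. If $\tilde\Lambda_{k+1}$ is diagonable, choose a $\Pi_k$-block-diagonal diagonaliser $\tilde M_{k+1}$, so that $\tilde M_{k+1}^{-1}\tilde\Lambda_{k+1}\tilde M_{k+1}=\Lambda_{k+1}$ is diagonal with equal entries within each $\Pi_k$-class in consecutive positions. Then, for small $\rho$, $\tilde A^{[k+1]}(\rho)=S(\rho)^{-1}\tilde A^{[k]}(\rho)S(\rho)$ with $S(\rho)=(I+\rho^{k+1}K^{[k]}_0)(I+\rho^{k}K^{[k]}_1)\cdots(I+\rho K^{[k]}_k)\tilde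 M_{k+1}$, and it has an expansion $\Lambda_0+\cdots+\rho^{k+1}\Lambda_{k+1}+\rho^{k+2}\tilde A^{[k+1]}_{k+2}+\cdots$, so that the scheme continues. The family $A(\rho)$ satisfies Assumption (A$_n$) if the matrices $\tilde\Lambda_k$, $k=0,1,\dots,n$, are all diagonable (with any fixed admissible choices in the scheme). The family $A(\rho)$ is non-degenerate of order $n$ in $\rho=0$ if it satisfies (A$_n$), the matrix $\tilde\Lambda_n$ consists of non-degenerate blocks (i.e. each of its diagonal blocks corresponding to the classes of $\Pi_{n-1}$ has pairwise distinct eigenvalues), and this number $n$ is minimal. *)

(* Defs.v *)
From mathcomp Require Export all_boot all_order all_algebra.
From mathcomp Require Export complex.
From mathcomp Require Export boolp classical_sets reals topology normedtype landau.

Set Implicit Arguments.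
Unset Strict Implicit.
Unset Printing Implicit Defensive.

Export Order.TTheory GRing.Theory Num.Theory.
Export numFieldNormedType.Exports.

Local Open Scope classical_set_scope.
Local Open Scope ring_scope.
Local Open Scope complex_scope.

(* [f rho = O(rho ^ N)] as the real variable rho tends to 0.  The regular
   module [R[i]^o] is where the library puts the topology of C = R[i];
   matrices carry the sup norm of their entries. *)
Definition bigO_pow (R : realType) (V : normedModType R[i])
    (f : R -> V) (N : nat) : Prop :=
  let at0 := nbhs (0 : R) in
  f =O_at0 (fun rho => rho%:C ^+ N : R[i]^o).

Definition full_expansion (R : realType) (m : nat)
    (F : R -> 'M[R[i]]_m) (Fc : nat -> 'M[R[i]]_m) : Prop :=
  forall N : nat,
    bigO_pow (fun rho => F rho - \sum_(k < N.+1) rho%:C ^+ k *: Fc k) N.+1.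

Definition bdiag (K : fieldType) (m : nat) (P : rel 'I_m) (X : 'M[K]_m) :
    'M[K]_m :=
  \matrix_(i, j) if P i j then X i j else 0.

Definition block_diagonal (K : fieldType) (m : nat) (P : rel 'I_m)
    (X : 'M[K]_m) : Prop :=
  X = bdiag P X.

Definition diag_block (K : fieldType) (m : nat) (D : {set 'I_m})
    (X : 'M[K]_m) : 'M[K]_#|D| :=
  mxsub enum_val enum_val X.

(* The eigenvalues, listed with algebraic multiplicity, are pairwise
   distinct. *)
Definition distinct_eigenvalues (K : fieldType) (p : nat) (X : 'M[K]_p) :
    Prop :=
  exists2 s : seq K, uniq s & char_poly X = \prod_(a <- s) ('X - a%:P).

(* Data chosen or computed along the scheme:
   - [diagzr k] is M_0 for k = 0 and the block-diagonal diagonaliser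
     \tilde M_k for k > 0;
   - [eigs k] is the diagonal (lambda^[k]_1, ..., lambda^[k]_m) of Lambda_k;
   - [coefs k j] is the coefficient \tilde A^[k]_j of rho ^ j in the
     expansion of the transformed family \tilde A^[k];
   - [corr k l] is K^[k]_l. *)
Record scheme (R : realType) (m : nat) := Scheme {
  diagzr : nat -> 'M[R[i]]_m;
  eigs : nat -> 'rV[R[i]]_m;
  coefs : nat -> nat -> 'M[R[i]]_m;
  corr : nat -> nat -> 'M[R[i]]_m
}.

(* [part d l] is the equivalence of Pi_(l-1): the index is shifted by one so
   that the trivial partition Pi_(-1) is [part d 0]. *)
Definition part (R : realType) (m : nat) (d : scheme R m) (l : nat) :
    rel 'I_m :=
  fun i j => [forall k : 'I_l, eigs d k 0 i == eigs d k 0 j].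

(* [refined d k l] is A^[k,l-1]_(k+1), with the convention
   A^[k,-1]_(k+1) = \tilde A^[k]_(k+1). *)
Fixpoint refined (R : realType) (m : nat) (d : scheme R m) (k l : nat) :
    'M[R[i]]_m :=
  match l with
  | 0%N => coefs d k k.+1
  | l'.+1 => bdiag (part d l'.+1) (refined d k l')
  end.

(* \tilde Lambda_k, for a family with leading coefficient A0. *)
Definition tLambda (R : realType) (m : nat) (A0 : 'M[R[i]]_m)
    (d : scheme R m) (k : nat) : 'M[R[i]]_m :=
  match k with
  | 0%N => A0
  | k'.+1 => refined d k' k'.+1
  end.

(* The matrix S(rho) of step k+1; the factors are multiplied from left to
   right in increasing order of l. *)
Definition transfo (R : realType) (m : nat) (d : scheme R m) (k : nat)
    (rho : R) : 'M[R[i]]_m :=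
  (\prod_(l < k.+1) (1%:M + rho%:C ^+ (k.+1 - l) *: corr d k l))
    *m diagzr d k.+1.

(* \tilde A^[k](rho); it is only meaningful for small rho, where the matrices
   S(rho) are invertible. *)
Fixpoint transformed (R : realType) (m : nat) (A : R -> 'M[R[i]]_m)
    (d : scheme R m) (k : nat) (rho : R) : 'M[R[i]]_m :=
  match k with
  | 0%N => invmx (diagzr d 0) *m A rho *m diagzr d 0
  | k'.+1 =>
      invmx (transfo d k' rho) *m transformed A d k' rho *m transfo d k' rho
  end.

(* [diagzr d k] is a Pi_(k-1)-block-diagonal diagonaliser of \tilde Lambda_k,
   with equal entries of Lambda_k within each Pi_(k-1)-class in consecutive
   positions. *)
Definition diagonaliser_choice (R : realType) (m : nat) (A0 : 'M[R[i]]_m)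
    (d : scheme R m) (k : nat) : Prop :=
  let M := diagzr d k in
  [/\ M \in unitmx,
      block_diagonal (part d k) M,
      invmx M *m tLambda A0 d k *m M = diag_mx (eigs d k)
    & forall i j l : 'I_m, (i < j < l)%N ->
        part d k i l -> eigs d k 0 i = eigs d k 0 l ->
        part d k i j /\ eigs d k 0 i = eigs d k 0 j].

(* The matrices K^[k]_0, ..., K^[k]_k used in step k+1. *)
Definition corrections (R : realType) (m : nat) (d : scheme R m) (k : nat) :
    Prop :=
  forall l : nat, (l <= k)%N ->
    let Ll := diag_mx (eigs d l) in
    let K := corr d k l in
    [/\ (Ll *m K - K *m Ll) + refined d k l - refined d k l.+1 = 0,
        block_diagonal (part d l) K
      & forall i j : 'I_m, part d l.+1 i j -> K i j = 0].

(* [d] records admissible choices with which the scheme can be carried out at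
   least until \tilde Lambda_n is obtained. *)
Definition scheme_until (R : realType) (m : nat) (A : R -> 'M[R[i]]_m)
    (A0 : 'M[R[i]]_m) (d : scheme R m) (n : nat) : Prop :=
  forall k : nat, (k < n)%N ->
    [/\ diagonaliser_choice A0 d k,
        full_expansion (transformed A d k) (coefs d k)
      & corrections d k].

(* Assumption (A_n), for the choices [d]. *)
Definition assumption_A (R : realType) (m : nat) (A : R -> 'M[R[i]]_m)
    (A0 : 'M[R[i]]_m) (d : scheme R m) (n : nat) : Prop :=
  scheme_until A A0 d n /\
  forall k : nat, (k <= n)%N -> diagonalizable (tLambda A0 d k).

Definition nondegenerate_blocks (R : realType) (m : nat) (A0 : 'M[R[i]]_m)
    (d : scheme R m) (n : nat) : Prop :=
  forall i : 'I_m,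
    distinct_eigenvalues
      (diag_block [set j | part d n i j]%SET (tLambda A0 d n)).

(* Minimality of n is understood for the same choices [d]. *)
Definition nondegenerate_of_order (R : realType) (m : nat)
    (A : R -> 'M[R[i]]_m) (A0 : 'M[R[i]]_m) (n : nat) : Prop :=
  exists d : scheme R m,
    [/\ assumption_A A A0 d n,
        nondegenerate_blocks A0 d n
      & forall n' : nat, (n' < n)%N ->
          ~ (assumption_A A A0 d n' /\ nondegenerate_blocks A0 d n')].

(* Main.v *)
Require Import Defs.
From mathcomp Require Import ring interval_inference.

(* The step matrices of the scheme intertwine A(rho), up to O(rho^(n+1)), with
   D(rho) = diag(mu_i(rho)), where mu_i(rho) is the polynomial with coefficients
   lambda_i^[0], ..., lambda_i^[n].  Non-degeneracy says that the mu_i are pairwise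
   distinct polynomials, hence |mu_i - mu_j| >= g |rho|^n with g > 0, which beats the
   error O(rho^(n+1)).
   So the exact eigenvalues are separated and are labelled by the mu_i, and the
   theorem is proved with exact eigenvectors V (normalised by V_ii = 1) instead of a
   formal diagonalisation: no Borel summation is needed.  V has a full expansion
   because its eigenvector equation has the shape V = rho Phi(rho, V), so each
   substitution of an expansion of V into it yields one more order.
   If n > 0, minimality of n gives i != j in the same class of Pi_(n-1), and
   mu_i - mu_j is then a multiple of rho^n. *)

(** The labels are chosen separately at each rho: the eigenvalues of the conjugated family B = T^-1
    A T are matched with the mu_i by a perturbation bound whose constant depends on m alone. Nothing
    relates the choices at different rho beforehand; continuity of the labels and the expansion of V
    are recovered from closeness to the polynomials mu_i and from their separation. The separation
    may degenerate at rho = 0, which is the obstacle. Off 0 the eigenvalues are simple, and the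
    continuity of the characteristic polynomial suffices; at 0 continuity comes from lambda_i = mu_i
    + O(rho^(n+1)). Likewise the eigenvector equation must first be divided by the exact power rho^d
    occurring in mu_i - mu_j; since d <= n, the error of order n+1 still leaves a factor rho.
    Counting the eigenvalues in Gershgorin discs would call for a homotopy argument; deflating one
    eigenvalue at a time gives the labelling with multiplicities by pure algebra, even when some of
    the mu_i coincide. *)

Set Implicit Arguments.
Unset Strict Implicit.
Unset Printing Implicit Defensive.

Local Open Scope classical_set_scope.
Local Open Scope ring_scope.
Local Open Scope complex_scope.

(** * Asymptotics of scalar functions *)

Section ScalarAsymptotics.
Context {R : realType}.
Local Notation C := R[i].
Implicit Types (f g h : R -> C) (p q : {poly C}).

(** The neighbourhood is not punctured: for [N > 0] the bound forces [f 0 = 0], so values at 0 have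
    to be tracked throughout. In [C], [0 <= c] says that [c] is a nonnegative real. *)
Definition isO (N : nat) f : Prop :=
  exists2 c : C, 0 <= c & \forall x \near (0 : R), `|f x| <= c * `|x%:C| ^+ N.

Lemma isO_near N f g : (\forall x \near (0 : R), f x = g x) -> isO N f -> isO N g.
Proof.
move=> fg [c c0 cf]; exists c => //; near=> x.
have <- : f x = g x by near: x.
by near: x.
Unshelve. all: by end_near. Qed.

Lemma isO_ext N f g : f =1 g -> isO N f -> isO N g.
Proof.
by move=> fg; apply: isO_near; near=> x; exact: fg.
Unshelve. all: by end_near. Qed.

Lemma isO0 N : isO N (fun=> 0).
Proof. by exists 0 => //; near=> x; rewrite normr0 mul0r.
Unshelve. all: by end_near. Qed.

Lemma isOD N f g : isO N f -> isO N g -> isO N (fun x => f x + g x).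
Proof.
move=> [c c0 cf] [d d0 dg]; exists (c + d); first exact: addr_ge0.
near=> x; rewrite mulrDl (le_trans (ler_normD _ _))// lerD//; by near: x.
Unshelve. all: by end_near. Qed.

Lemma isON N f : isO N f -> isO N (fun x => - f x).
Proof.
by move=> [c c0 cf]; exists c => //; near=> x; rewrite normrN; near: x.
Unshelve. all: by end_near. Qed.

Lemma isOB N f g : isO N f -> isO N g -> isO N (fun x => f x - g x).
Proof. by move=> Of Og; apply: isOD => //; apply: isON. Qed.

Lemma isOM M N f g : isO M f -> isO N g -> isO (M + N) (fun x => f x * g x).
Proof.
move=> [c c0 cf] [d d0 dg]; exists (c * d); first exact: mulr_ge0.
near=> x; rewrite normrM exprD mulrACA ler_pM//; by near: x.
Unshelve. all: by end_near. Qed.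

Lemma isO_cst (a : C) : isO 0 (fun=> a).
Proof. by exists `|a| => //; near=> x; rewrite expr0 mulr1.
Unshelve. all: by end_near. Qed.

Lemma isOX k : isO k (fun x => x%:C ^+ k).
Proof. by exists 1 => //; near=> x; rewrite normrX mul1r.
Unshelve. all: by end_near. Qed.

Lemma normC_real (x : R) : `|x%:C| = (`|x|)%:C.
Proof. by rewrite normc_def /= expr0n addr0 sqrtr_sqr. Qed.

Lemma near0_small (e : C) : 0 < e -> \forall x \near (0 : R), `|x%:C| <= e.
Proof.
move=> e0; have er : e \is Num.real by rewrite gtr0_real.
have [d de] := complex_realP _ er; rewrite de ltcR in e0 *.
apply/nbhs_ballP; exists d => //= x; rewrite /ball /= sub0r normrN.
by rewrite normC_real lecR => /ltW.
Qed.

Lemma isO_le M N f : (M <= N)%N -> isO N f -> isO M f.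
Proof.
move=> MN [c c0 cf]; exists c => //; near=> x.
apply: (@le_trans _ _ (c * `|x%:C| ^+ N)); first by near: x.
rewrite ler_wpM2l// -(subnK MN) exprD ler_piMl ?exprn_ge0// exprn_ile1//.
by near: x; apply: near0_small.
Unshelve. all: by end_near. Qed.

Lemma isOMl N f g : isO 0 f -> isO N g -> isO N (fun x => f x * g x).
Proof. exact: isOM. Qed.

Lemma isOMr N f g : isO N f -> isO 0 g -> isO N (fun x => f x * g x).
Proof. by move=> Of Og; rewrite -(addn0 N); apply: isOM. Qed.

Lemma isO_sum N (I : Type) (r : seq I) (P : pred I) (F : I -> R -> C) :
  (forall i, P i -> isO N (F i)) -> isO N (fun x => \sum_(i <- r | P i) F i x).
Proof.
move=> HF; elim: r => [|i r IH].
  by apply: isO_ext (isO0 N) => x; rewrite big_nil.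
case Pi: (P i); last by apply: isO_ext IH => x; rewrite big_cons Pi.
by apply: isO_ext (isOD (HF i Pi) IH) => x; rewrite big_cons Pi.
Qed.

Lemma isO_poly0 p : isO 0 (fun x => p.[x%:C]).
Proof.
apply: (@isO_ext 0 (fun x => \sum_(i < size p) p`_i * x%:C ^+ i)) => [x|].
  by rewrite horner_coef.
apply: isO_sum => i _; apply: isOMl; first exact: isO_cst.
by apply: isO_le (isOX i).
Qed.

Lemma isO_at0 N f : isO N.+1 f -> f 0 = 0.
Proof.
move=> [c c0 /nbhs_singleton]; rewrite raddf0 normr0 expr0n mulr0 normr_le0.
by move/eqP.
Qed.

(** One spare power of x pays for an arbitrarily small constant. *)
Lemma isO_near_small N f (e : C) : 0 < e -> isO N.+1 f ->
  \forall x \near (0 : R), `|f x| <= e * `|x%:C| ^+ N.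
Proof.
move=> e0 [c c0 cf]; have c1 : 0 < c + 1 by rewrite ltr_wpDl.
near=> x; apply: (@le_trans _ _ (c * `|x%:C| ^+ N.+1)); first by near: x.
rewrite exprS mulrA ler_wpM2r ?exprn_ge0//.
apply: (@le_trans _ _ ((c + 1) * `|x%:C|)); first by rewrite ler_wpM2r// lerDl.
rewrite mulrC -ler_pdivlMr//; near: x; apply: near0_small; exact: divr_gt0.
Unshelve. all: by end_near. Qed.

Lemma exists_near0 (P : set R) : (\forall x \near (0 : R), P x) ->
  exists2 x : R, x != 0 & P x.
Proof.
move=> /nbhs_ballP [e /= e0 H]; exists (e / 2).
  by rewrite gt_eqF// divr_gt0.
apply: H; rewrite /ball /= sub0r normrN gtr0_norm ?divr_gt0//.
by rewrite ltr_pdivrMr// ltr_pMr// ltr1n.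
Qed.

Lemma polyX_mulE p : p.[0] = 0 -> exists q, p = q * 'X.
Proof.
move=> /eqP; rewrite -/(root p 0) => /factor_theorem[q ->]; exists q.
by rewrite subr0.
Qed.

Lemma poly_isO1 p : p.[0] = 0 -> isO 1 (fun x => p.[x%:C]).
Proof.
move=> /polyX_mulE[q ->]; apply: isO_ext (isOMl (isO_poly0 q) (isOX 1)) => x.
by rewrite hornerMX expr1.
Qed.

(** Off 0 the factor x^k cancels. At 0 the relation between f and g may say nothing about [g 0]; the
    disjunction supplies the bound there, and [|g 0|] enters the constant for the case N = 0. *)
Lemma isO_div k N f g : isO (k + N) f -> (\forall x \near (0 : R), f x = x%:C ^+ k * g x) ->
  (N = 0%N \/ g 0 = 0) -> isO N g.
Proof.
move=> [c c0 cf] fg Ng; exists (c + `|g 0|); first exact: addr_ge0.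
near=> x; have [->|x0] := eqVneq x 0.
  case: Ng => [->|->]; first by rewrite expr0 mulr1 lerDr.
  by rewrite normr0 mulr_ge0 ?exprn_ge0// addr_ge0.
have xC0 : 0 < `|x%:C| ^+ k by rewrite exprn_gt0// normr_gt0 fmorph_eq0.
rewrite -(ler_pM2l xC0) -normrX -normrM -(near fg x)//.
apply: (@le_trans _ _ (c * `|x%:C| ^+ (k + N))); first by near: x.
by rewrite normrX mulrCA -exprD ler_wpM2r ?exprn_ge0// lerDl.
Unshelve. all: by end_near. Qed.

(* The bound says nothing about p / 'X at x = 0; its value there is recovered by continuity. *)
Lemma isO_polyXn N p : isO N (fun x => p.[x%:C]) -> exists q, p = q * 'X^N.
Proof.
elim: N p => [|N IH] p Op; first by exists p; rewrite expr0 mulr1.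
have [q pq] : exists q, p = q * 'X by apply: polyX_mulE; exact: (isO_at0 Op).
suff /IH[r qr] : isO N (fun x => q.[x%:C]) by exists r; rewrite pq qr exprSr mulrA.
apply: (@isO_div 1 _ _ _ Op) => [|].
  by near=> x; rewrite pq hornerMX expr1 mulrC.
case: N Op {IH} => [|N] Op; [by left|right].
apply/eqP; rewrite -normr_le0; apply/ler_addgt0Pl => e e0; rewrite addr0.
have e2 : 0 < e / 2 by rewrite divr_gt0.
have O1 : isO 1 (fun x => (q - q.[0]%:P).[x%:C]).
  by apply: poly_isO1; rewrite !hornerE subrr.
have S1 := isO_near_small e2 O1.
have [|x x0] := @exists_near0 (fun x =>
  `|(q - q.[0]%:P).[x%:C]| <= e / 2 /\ `|p.[x%:C]| <= e / 2 * `|x%:C|).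
  near=> x; split; first by rewrite -[leRHS]mulr1 -(expr0 `|x%:C|); near: x.
  rewrite -[X in _ * X]expr1; near: x; apply: isO_near_small => //.
  exact: isO_le Op.
rewrite pq hornerMX normrM ler_pM2r ?normr_gt0 ?fmorph_eq0// => -[H1 H2].
have -> : q.[0] = q.[x%:C] - (q - q.[0]%:P).[x%:C] by rewrite !hornerE; ring.
by rewrite (le_trans (ler_normB _ _))// [leRHS]splitr lerD.
Unshelve. all: by end_near. Qed.

(** The polynomial has no degree bound and its coefficients are not named, so approximants are added
    and multiplied without truncation. Order 0 is boundedness near 0, the base case of the
    inductions on the order. *)
Definition expands_to (N : nat) f : Prop := exists p, isO N (fun x => f x - p.[x%:C]).
Definition expands f : Prop := forall N, expands_to N f.

Lemma expands_to_near N f g : (\forall x \near (0 : R), f x = g x) -> expands_to N f ->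
  expands_to N g.
Proof.
move=> fg [p Op]; exists p; apply: isO_near Op; near=> x.
by rewrite (near fg x).
Unshelve. all: by end_near. Qed.

Lemma expands_to_ext N f g : f =1 g -> expands_to N f -> expands_to N g.
Proof. by move=> fg [p Op]; exists p; apply: isO_ext Op => x; rewrite fg. Qed.

Lemma expands_to_isO0 N f : expands_to N f -> isO 0 f.
Proof.
move=> [p Op]; apply: isO_ext (isOD (isO_le (leq0n N) Op) (isO_poly0 p)) => x.
by rewrite subrK.
Qed.

Lemma expands_to0 f : isO 0 f -> expands_to 0 f.
Proof. by move=> Of; exists 0; apply: isO_ext Of => x; rewrite horner0 subr0. Qed.

Lemma expands_poly p : expands (fun x => p.[x%:C]).
Proof. by move=> N; exists p; apply: isO_ext (isO0 N) => x; rewrite subrr. Qed.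

Lemma expands_cst (a : C) : expands (fun=> a).
Proof. by move=> N; apply: expands_to_ext (expands_poly a%:P N) => x; rewrite hornerC. Qed.

Lemma expandsX k : expands (fun x => x%:C ^+ k).
Proof. by move=> N; apply: expands_to_ext (expands_poly 'X^k N) => x; rewrite hornerXn. Qed.

Lemma expands_to_D N f g : expands_to N f -> expands_to N g ->
  expands_to N (fun x => f x + g x).
Proof.
move=> [p Op] [q Oq]; exists (p + q); apply: isO_ext (isOD Op Oq) => x.
by rewrite hornerD; ring.
Qed.

Lemma expands_to_M N f g : expands_to N f -> expands_to N g ->
  expands_to N (fun x => f x * g x).
Proof.
move=> [p Op] [q Oq]; exists (p * q).
have Og : isO 0 g by apply: (@expands_to_isO0 N); exists q.
apply: isO_ext (isOD (isOMr Op Og) (isOMl (isO_poly0 p) Oq)) => x.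
by rewrite hornerM; ring.
Qed.

(** This gain of one order drives the inductions for inverses and for eigenvectors. *)
Lemma expands_to_mulX N f : expands_to N f -> expands_to N.+1 (fun x => x%:C * f x).
Proof.
move=> [p Op]; exists ('X * p); apply: isO_ext (isOM (isOX 1) Op) => x.
by rewrite hornerM hornerX expr1; ring.
Qed.

Lemma expands_to_N N f : expands_to N f -> expands_to N (fun x => - f x).
Proof.
move=> Ff; apply: expands_to_ext (expands_to_M (expands_cst (-1) N) Ff) => x; exact: mulN1r.
Qed.

Lemma expands_to_sum N (I : Type) (r : seq I) (P : pred I) (F : I -> R -> C) :
  (forall i, P i -> expands_to N (F i)) -> expands_to N (fun x => \sum_(i <- r | P i) F i x).
Proof.
move=> HF; elim: r => [|i r IH].
  by apply: expands_to_ext (expands_cst 0 N) => x; rewrite big_nil.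
case Pi: (P i); last by apply: expands_to_ext IH => x; rewrite big_cons Pi.
by apply: expands_to_ext (expands_to_D (HF i Pi) IH) => x; rewrite big_cons Pi.
Qed.

Lemma expands_to_prod N (I : Type) (r : seq I) (P : pred I) (F : I -> R -> C) :
  (forall i, P i -> expands_to N (F i)) -> expands_to N (fun x => \prod_(i <- r | P i) F i x).
Proof.
move=> HF; elim: r => [|i r IH].
  by apply: expands_to_ext (expands_cst 1 N) => x; rewrite big_nil.
case Pi: (P i); last by apply: expands_to_ext IH => x; rewrite big_cons Pi.
by apply: expands_to_ext (expands_to_M (HF i Pi) IH) => x; rewrite big_cons Pi.
Qed.

(** The difference of the two polynomials is O(x^N), hence a multiple of X^N. *)
Lemma isO_poly_uniq N f p q :
  isO N (fun x => f x - p.[x%:C]) -> isO N (fun x => f x - q.[x%:C]) ->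
  forall k, (k < N)%N -> p`_k = q`_k.
Proof.
move=> Op Oq k kN; have [r /(congr1 (fun s : {poly C} => s`_k))] : exists r, q - p = r * 'X^N.
  by apply: isO_polyXn; apply: isO_ext (isOB Op Oq) => x; rewrite !hornerE; ring.
by rewrite coefB coefMXn kN => /eqP; rewrite subr_eq0 => /eqP.
Qed.

Lemma isO_take_poly M N p : (M <= N)%N ->
  isO M (fun x => p.[x%:C] - (\poly_(k < N) p`_k).[x%:C]).
Proof.
move=> MN; apply: isO_le MN _.
apply: isO_ext (isOMl (isO_poly0 (drop_poly N p)) (isOX N)) => x.
rewrite -hornerXn -hornerM -{2}(poly_take_drop N p) hornerD.
have -> : \poly_(k < N) p`_k = take_poly N p by [].
by rewrite addrAC subrr add0r.
Qed.

(** The k-th coefficient is read off an approximation of order k+1. By uniqueness all better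
    approximations share it, so one sequence serves every order. *)
Lemma expands_coefs f : expands f -> exists a : nat -> C,
  forall N, isO N (fun x => f x - (\poly_(k < N) a k).[x%:C]).
Proof.
move=> /boolp.choice[P HP]; exists (fun k => (P k.+1)`_k) => N.
suff -> : \poly_(k < N) (P k.+1)`_k = \poly_(k < N) (P N)`_k.
  by apply: isO_ext (isOD (HP N) (isO_take_poly (P N) (leqnn N))) => x; ring.
apply/polyP => k; rewrite !coef_poly; case: ifP => // kN.
exact: isO_poly_uniq (HP k.+1) (isO_le kN (HP N)) _ _.
Qed.

Lemma expands_div k f : expands f -> isO k f ->
  exists2 g, expands g & \forall x \near (0 : R), f x = x%:C ^+ k * g x.
Proof.
move=> Ff Of; have [a Ha] := expands_coefs Ff.
(* The bounds on the quotient include x = 0, so its value there must be the first surviving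
   coefficient. *)
pose g (x : R) := if x == 0 then a k else f x / x%:C ^+ k.
have a0 j : (j < k)%N -> a j = 0.
  move=> jk; have O0 : isO k (fun x => f x - (0 : {poly C}).[x%:C]).
    by apply: isO_ext Of => x; rewrite horner0 subr0.
  by have := isO_poly_uniq (Ha k) O0 jk; rewrite coef_poly jk coef0.
have fg x : f x = x%:C ^+ k * g x.
  rewrite /g; case: eqVneq => [->|x0]; last first.
    by rewrite mulrC mulfVK// expf_neq0 ?fmorph_eq0.
  case: k Of Ha {g} a0 => [|k] Of Ha a0; last by rewrite (isO_at0 Of) raddf0 expr0n mul0r.
  have := isO_at0 (Ha 1%N); rewrite horner_poly big_ord1 expr0 !mulr1 mul1r.
  by move/eqP; rewrite subr_eq0 => /eqP.
exists g; last by near=> x; exact: fg.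
move=> N; exists (\poly_(j < N) a (k + j)%N).
apply: (@isO_div k _ (fun x => f x - (\poly_(j < k + N) a j).[x%:C])) (Ha _) _ _.
  near=> x; rewrite mulrBr -fg; congr (_ - _).
  rewrite !horner_poly big_split_ord /= big1 ?add0r; last first.
    by move=> i _; rewrite a0 ?mul0r.
  by rewrite mulr_sumr; apply: eq_bigr => i _; rewrite exprD; ring.
case: N => [|N]; [by left|right].
rewrite horner_poly big_ord_recl expr0 addn0 mulr1 /g eqxx big1 ?addr0 ?subrr// => i _.
by rewrite raddf0 expr0n mulr0.
Unshelve. all: by end_near. Qed.

Lemma expands_small f : expands f -> isO 1 (fun x => f x - f 0).
Proof.
move=> /(_ 1%N)[p Op]; have := isO_at0 Op; rewrite raddf0 => /eqP.
rewrite subr_eq0 => /eqP ->.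
have Oq : isO 1 (fun x => (p - p.[0]%:P).[x%:C]).
  by apply: poly_isO1; rewrite !hornerE subrr.
by apply: isO_ext (isOD Op Oq) => x; rewrite hornerD hornerN hornerC; ring.
Qed.

Lemma expands_away f : expands f -> f 0 != 0 ->
  \forall x \near (0 : R), `|f 0| / 2 <= `|f x|.
Proof.
move=> Ff f0; have e0 : 0 < `|f 0| / 2 by rewrite divr_gt0// normr_gt0.
have := isO_near_small e0 (expands_small Ff); apply: filterS => x.
rewrite expr0 mulr1 distrC => H.
rewrite -(lerD2l (`|f 0| / 2)) -splitr (le_trans _ (lerD H (lexx _)))//.
by rewrite (le_trans _ (ler_normD _ _))// subrK.
Qed.

Lemma expands_inv f : expands f -> f 0 != 0 -> expands (fun x => (f x)^-1).
Proof.
move=> Ff f0; have [g Fg fg] := expands_div (fun N =>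
  expands_to_D (Ff N) (expands_to_N (expands_cst (f 0) N))) (expands_small Ff).
have away := expands_away Ff f0.
have nf0 : 0 < `|f 0| by rewrite normr_gt0.
elim=> [|N IH].
  apply: expands_to0; exists (`|f 0| / 2)^-1; first by rewrite invr_ge0 divr_ge0.
  near=> x; rewrite expr0 mulr1 normfV.
  have H : `|f 0| / 2 <= `|f x| by near: x.
  by rewrite lef_pV2// posrE ?divr_gt0// (lt_le_trans _ H)// divr_gt0.
(* f^-1 = f(0)^-1 (1 - x g f^-1) gains one order. *)
apply: expands_to_near (expands_to_M (expands_cst (f 0)^-1 _)
  (expands_to_D (expands_cst 1 _) (expands_to_N (expands_to_mulX (expands_to_M (Fg N) IH))))).
near=> x.
have H : `|f 0| / 2 <= `|f x| by near: x.
have fx0 : f x != 0 by rewrite -normr_gt0 (lt_le_trans _ H)// divr_gt0.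
have : f x - f 0 = x%:C ^+ 1 * g x by near: x.
rewrite expr1 mulrA => <-; field; by rewrite f0 fx0.
Unshelve. all: by end_near. Qed.

End ScalarAsymptotics.

(** * Asymptotics of matrix functions *)

Lemma mx_norm_le (K : numDomainType) (m n : nat) (M : 'M[K]_(m, n)) (c : K) :
  0 <= c -> `|M| <= c <-> forall i j, `|M i j| <= c.
Proof.
move=> c0; split=> [Mc i j|H].
  apply: le_trans Mc; rewrite /Num.norm /= mx_normE [leLHS](_ : _ = `|M i j|%:nng%:num)//.
  by rewrite num_le; apply/bigmax_geP; right => /=; exists (i, j).
rewrite /Num.norm /=; have [->//|/mx_norm_neq0[[i j] ->]] := eqVneq (mx_norm M) 0.
exact: H.
Qed.

Section MatrixAsymptotics.
Context {R : realType}.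
Local Notation C := R[i].

(** * Entrywise forms of the asymptotic notions of the statement *)

Lemma scalar_bigO_powP (f : R -> C) (N : nat) :
  bigO_pow (f : R -> R[i]^o) N <-> isO N f.
Proof.
split=> [/eqO_exP[c c0 H]|[c c0 H]].
  by exists c; [exact: ltW|apply: filterS H => x; rewrite normrX].
apply/eqO_exP; exists (c + 1); first by rewrite ltr_wpDl.
apply: filterS H => x H; rewrite normrX (le_trans H)// ler_wpM2r ?exprn_ge0//.
by rewrite lerDl.
Qed.

Lemma near0_forall (I : finType) (P : I -> R -> Prop) :
  (forall i, \forall x \near (0 : R), P i x) -> \forall x \near (0 : R), forall i, P i x.
Proof. move=> H; exact: (filter_forall (nbhs_filter (0 : R)) H). Qed.

Definition mx_isO m (N : nat) (F : R -> 'M[C]_m) := forall i j, isO N (fun x => F x i j).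
Definition mx_expands m (F : R -> 'M[C]_m) := forall i j, expands (fun x => F x i j).

Lemma mx_isO_uniform m N (F : R -> 'M[C]_m) : mx_isO N F ->
  exists2 c : C, 0 <= c & \forall x \near (0 : R), forall i j, `|F x i j| <= c * `|x%:C| ^+ N.
Proof.
move=> OF; have H (p : 'I_m * 'I_m) : exists c : C,
    0 <= c /\ \forall x \near (0 : R), `|F x p.1 p.2| <= c * `|x%:C| ^+ N.
  by have [c c0 H] := OF p.1 p.2; exists c.
have {H} [c Hc] := boolp.choice H.
exists (\sum_p c p); first by apply: sumr_ge0 => p _; case: (Hc p).
have := near0_forall (fun p => (Hc p).2); apply: filterS => x H i j.
rewrite (le_trans (H (i, j)))// ler_wpM2r ?exprn_ge0//.
rewrite (bigD1 (i, j))//= lerDl; apply: sumr_ge0 => p _; by case: (Hc p).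
Qed.

Lemma matrix_bigO_powP m (F : R -> 'M[C]_m) (N : nat) : bigO_pow F N <-> mx_isO N F.
Proof.
split=> [/eqO_exP[c c0 H] i j|/mx_isO_uniform[c c0 H]].
  exists c; first exact: ltW.
  apply: filterS H => x; rewrite normrX mx_norm_le; last first.
    by rewrite mulr_ge0 ?exprn_ge0// ltW.
  exact.
apply/eqO_exP; exists (c + 1); first by rewrite ltr_wpDl.
apply: filterS H => x H; rewrite normrX mx_norm_le => [i j|]; last first.
  by rewrite mulr_ge0 ?exprn_ge0// addr_ge0.
by rewrite (le_trans (H i j))// ler_wpM2r ?exprn_ge0// lerDl.
Qed.

Lemma bounded_nearP m (F : R -> 'M[C]_m) : mx_isO 0 F -> bounded_near F (nbhs (0 : R)).
Proof.
move=> /mx_isO_uniform[c c0 H]; have cr : c \is Num.real by rewrite ger0_real.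
have := nbhs_pinfty_ge cr; apply: filterS => M cM.
apply: filterS H => x H /=; rewrite mx_norm_le ?(le_trans c0)// => i j.
by rewrite (le_trans (H i j))// expr0 mulr1.
Qed.

Lemma expansion_entry m (Fc : nat -> 'M[C]_m) N (x : R) i j :
  (\sum_(k < N) x%:C ^+ k *: Fc k) i j = (\poly_(k < N) Fc k i j).[x%:C].
Proof.
by rewrite summxE horner_poly; apply: eq_bigr => k _; rewrite mxE mulrC.
Qed.

Lemma full_expansionP m (F : R -> 'M[C]_m) (Fc : nat -> 'M[C]_m) :
  full_expansion F Fc <->
  forall i j N, isO N (fun x => F x i j - (\poly_(k < N) Fc k i j).[x%:C]).
Proof.
split=> H => [i j N|N]; last first.
  by apply/matrix_bigO_powP => i j; apply: isO_ext (H i j N.+1) => x;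
    rewrite !mxE expansion_entry.
have HN M : isO M.+1 (fun x => F x i j - (\poly_(k < M.+1) Fc k i j).[x%:C]).
  by have /matrix_bigO_powP/(_ i j) := H M; apply: isO_ext => x; rewrite !mxE expansion_entry.
(* [full_expansion] only speaks of errors of order at least 1; order 0 follows because an
   approximation of order 1 makes the entry bounded. *)
case: N => // ; apply: expands_to_isO0 => //.
apply: (@expands_to_D _ 1); last by apply: expands_to_N;
  exact: (expands_poly (\poly_(k < 0) Fc k i j)).
by exists (\poly_(k < 1) Fc k i j).
Qed.

Lemma full_expansion_mx_expands m (F : R -> 'M[C]_m) (Fc : nat -> 'M[C]_m) :
  full_expansion F Fc -> mx_expands F.
Proof. by move=> /full_expansionP H i j N; exists (\poly_(k < N) Fc k i j). Qed.

Lemma mx_expands_full_expansion m (F : R -> 'M[C]_m) :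
  mx_expands F -> exists Fc, full_expansion F Fc.
Proof.
move=> FF; have [a Ha] := boolp.choice (fun p : 'I_m * 'I_m => expands_coefs (FF p.1 p.2)).
exists (fun k => \matrix_(i, j) a (i, j) k); apply/full_expansionP => i j N.
apply: isO_ext (Ha (i, j) N) => x; congr (_ - _.[_]).
by apply/polyP => k; rewrite !coef_poly; case: ifP; rewrite ?mxE.
Qed.

(** * Algebra of entrywise bounds and expansions *)

Lemma mx_isO_near m N (F G : R -> 'M[C]_m) :
  (\forall x \near (0 : R), F x = G x) -> mx_isO N F -> mx_isO N G.
Proof.
move=> FG OF i j; apply: isO_near (OF i j).
by apply: filterS FG => x ->.
Qed.

Lemma mx_isO_ext m N (F G : R -> 'M[C]_m) : F =1 G -> mx_isO N F -> mx_isO N G.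
Proof. by move=> FG OF i j; apply: isO_ext (OF i j) => x; rewrite FG. Qed.

Lemma mx_isO_le m M N (F : R -> 'M[C]_m) : (M <= N)%N -> mx_isO N F -> mx_isO M F.
Proof. by move=> MN OF i j; apply: isO_le (OF i j). Qed.

Lemma mx_isO_D m N (F G : R -> 'M[C]_m) : mx_isO N F -> mx_isO N G ->
  mx_isO N (fun x => F x + G x).
Proof.
by move=> OF OG i j; apply: isO_ext (isOD (OF i j) (OG i j)) => x; rewrite mxE.
Qed.

Lemma mx_isO_M m M N (F G : R -> 'M[C]_m) :
  mx_isO M F -> mx_isO N G -> mx_isO (M + N) (fun x => F x *m G x).
Proof.
move=> OF OG i j; apply: (isO_ext (f := fun x => \sum_k F x i k * G x k j)).
  by move=> x; rewrite mxE.
by apply: isO_sum => k _; apply: isOM.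
Qed.

Lemma mx_isO_cst m (X : 'M[C]_m) : mx_isO 0 (fun=> X).
Proof. by move=> i j; exact: isO_cst. Qed.

Lemma mx_isO_X m N k (F : R -> 'M[C]_m) : mx_isO N F ->
  mx_isO (k + N) (fun x => x%:C ^+ k *: F x).
Proof.
by move=> OF i j; apply: isO_ext (isOM (isOX k) (OF i j)) => x; rewrite mxE.
Qed.

Lemma mx_isO_sum m N (I : Type) (r : seq I) (P : pred I) (F : I -> R -> 'M[C]_m) :
  (forall i, P i -> mx_isO N (F i)) -> mx_isO N (fun x => \sum_(i <- r | P i) F i x).
Proof.
move=> H i j; apply: (isO_ext (f := fun x => \sum_(l <- r | P l) F l x i j)).
  by move=> x; rewrite summxE.
by apply: isO_sum => l Pl; exact: H.
Qed.

Lemma mx_expands_mO0 m (F : R -> 'M[C]_m) : mx_expands F -> mx_isO 0 F.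
Proof. by move=> FF i j; exact: expands_to_isO0 (FF i j 0%N). Qed.

Lemma mx_expands_near m (F G : R -> 'M[C]_m) :
  (\forall x \near (0 : R), F x = G x) -> mx_expands F -> mx_expands G.
Proof.
move=> FG FF i j N; apply: expands_to_near (FF i j N).
by apply: filterS FG => x ->.
Qed.

Lemma mx_expands_cst m (X : 'M[C]_m) : mx_expands (fun=> X).
Proof. by move=> i j; exact: expands_cst. Qed.

Lemma mx_expands_D m (F G : R -> 'M[C]_m) : mx_expands F -> mx_expands G ->
  mx_expands (fun x => F x + G x).
Proof.
by move=> FF FG i j N; apply: expands_to_ext (expands_to_D (FF i j N) (FG i j N)) => x;
  rewrite mxE.
Qed.

Lemma mx_expands_Z m (f : R -> C) (F : R -> 'M[C]_m) : expands f -> mx_expands F ->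
  mx_expands (fun x => f x *: F x).
Proof.
by move=> Ff FF i j N; apply: expands_to_ext (expands_to_M (Ff N) (FF i j N)) => x; rewrite mxE.
Qed.

Lemma mx_expands_M m (F G : R -> 'M[C]_m) : mx_expands F -> mx_expands G ->
  mx_expands (fun x => F x *m G x).
Proof.
move=> FF FG i j N; apply: (expands_to_ext (f := fun x => \sum_k F x i k * G x k j)).
  by move=> x; rewrite mxE.
by apply: expands_to_sum => k _; apply: expands_to_M; [exact: FF|exact: FG].
Qed.

Lemma expands_det m (F : R -> 'M[C]_m) : mx_expands F -> expands (fun x => \det (F x)).
Proof.
move=> FF N; apply: expands_to_sum => s _; apply: expands_to_M; first exact: expands_cst.
by apply: expands_to_prod => i _; exact: FF.
Qed.

Lemma mx_expands_adj m (F : R -> 'M[C]_m) : mx_expands F -> mx_expands (fun x => \adj (F x)).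
Proof.
move=> FF i j N; apply: (expands_to_ext (f :=
  fun x => (-1) ^+ (j + i) * \det (row' j (col' i (F x))))).
  by move=> x; rewrite mxE.
apply: expands_to_M; first exact: expands_cst.
apply: (expands_det (F := fun x => row' j (col' i (F x)))) => k l N'.
by apply: expands_to_ext (FF (lift j k) (lift i l) N') => x; rewrite !mxE.
Qed.

Lemma near_unitmx m (F : R -> 'M[C]_m) : mx_expands F -> F 0 \in unitmx ->
  \forall x \near (0 : R), F x \in unitmx.
Proof.
move=> FF; rewrite unitmxE unitfE => F0; have := expands_away (expands_det FF) F0.
apply: filterS => x H; rewrite unitmxE unitfE -normr_gt0 (lt_le_trans _ H)//.
by rewrite divr_gt0// normr_gt0.
Qed.

(** Cramer's rule reduces this to the inverse of a scalar, the determinant. *)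
Lemma mx_expands_inv m (F : R -> 'M[C]_m) : mx_expands F -> F 0 \in unitmx ->
  mx_expands (fun x => invmx (F x)).
Proof.
move=> FF F0; have d0 : \det (F 0) != 0 by rewrite -unitfE -unitmxE.
apply: mx_expands_near (mx_expands_Z (expands_inv (expands_det FF) d0) (mx_expands_adj FF)).
by have := near_unitmx FF F0; apply: filterS => x H; rewrite /invmx H.
Qed.

End MatrixAsymptotics.

(** * Perturbation of diagonal matrices *)

Lemma char_poly_similar (K : fieldType) (m : nat) (P B W : 'M[K]_m) :
  P \in unitmx -> P *m B = W *m P -> char_poly B = char_poly W.
Proof.
move=> Pu PBW; have Pn0 : \det (map_mx polyC P) != 0.
  by rewrite det_map_mx polyC_eq0 -unitfE -unitmxE.
have E : map_mx polyC P *m char_poly_mx B = char_poly_mx W *m map_mx polyC P.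
  by rewrite /char_poly_mx mulmxBr mulmxBl -!map_mxM PBW scalar_mxC.
apply: (mulfI Pn0); rewrite /char_poly -det_mulmx E det_mulmx mulrC //.
Qed.

Lemma char_poly_deflate (K : fieldType) (m : nat) (W : 'M[K]_m.+1) (i : 'I_m.+1) (a : K) :
  (forall j, W j i = a *+ (j == i)) ->
  char_poly W = ('X - a%:P) * char_poly (row' i (col' i W)).
Proof.
move=> Wi; rewrite /char_poly (expand_det_col _ i) (bigD1 i) //= big1 ?addr0.
  rewrite !mxE eqxx Wi eqxx !mulr1n; congr (_ * _).
  by rewrite /cofactor row'_col'_char_poly_mx -signr_odd addnn odd_double mul1r.
by move=> j ji; rewrite !mxE Wi (negPf ji) !mulr0n subr0 mul0r.
Qed.

(** An eigenvector is divided by its entry of largest modulus. The position [i] of that entry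
    indicates which mu_i the eigenvalue is close to. *)
Lemma normalised_eigenvector (K : numClosedFieldType) (m : nat) (B : 'M[K]_m) (a : K) :
  root (char_poly B) a ->
  exists v : 'cV[K]_m, exists i, [/\ B *m v = a *: v, v i 0 = 1 & forall j, `|v j 0| <= 1].
Proof.
move=> ra.
(* [eigenvalue] refers to row vectors, hence the transpose. *)
have : eigenvalue B^T a.
  rewrite eigenvalue_root_char; have -> // : char_poly B^T = char_poly B.
  by rewrite /char_poly -det_tr /char_poly_mx linearB /= tr_scalar_mx map_trmx trmxK.
move=> /eigenvalueP[w wB w0].
have [i0 _] : exists i, w 0 i != 0.
  by apply/existsP; apply: contraNT w0 => /existsPn H; apply/eqP/rowP => i;
     rewrite mxE; apply/eqP; have := H i; rewrite negbK.
have [i _ Hi] := @real_arg_maxP _ _ i0 predT (fun j => `|w 0 j|) isT (fun _ _ => normr_real _).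
have wi0 : w 0 i != 0.
  apply: contraNneq w0 => wi; apply/eqP/rowP => j; rewrite mxE; apply/eqP.
  by have : `|w 0 j| <= `|w 0 i| := Hi j isT; rewrite wi normr0 normr_le0.
exists ((w 0 i)^-1 *: w^T), i; split.
- by rewrite -scalemxAr -[B]trmxK -trmx_mul wB linearZ /= !scalerA mulrC.
- by rewrite !mxE mulVf.
move=> j; rewrite !mxE normrM normfV mulrC ler_pdivrMr ?normr_gt0// mul1r; exact: Hi.
Qed.

(* Deflation: with an eigenvector v normalised by v_i = 1 and |v_j| <= 1, the
   remaining block B_jk - v_j B_ik is again a perturbation of a diagonal matrix,
   of twice the size. *)
Lemma eigenvalue_perturbation (K : numClosedFieldType) (m : nat) (mu : 'I_m -> K)
    (B : 'M[K]_m) (e : K) :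
  (forall i j, `|B i j - mu i *+ (i == j)| <= e) ->
  exists l : 'I_m -> K, char_poly B = \prod_i ('X - (l i)%:P) /\
    forall i, `|l i - mu i| <= (m * 2 ^ m)%:R * e.
Proof.
elim: m mu B e => [|m IH] mu B e HB.
  exists (fun=> 0); split; last by case.
  by rewrite big_ord0 /char_poly det_mx00.
have e0 : 0 <= e := le_trans (normr_ge0 _) (HB ord0 ord0).
have [a ra] : exists a, root (char_poly B) a.
  by apply/closed_rootP; rewrite size_char_poly.
have [v [i [Bv vi v1]]] := normalised_eigenvector ra.
(* [1 + N] replaces the i-th basis vector by v. As u_i = 0, N squares to zero and [1 - N] is the
   inverse. *)
pose u := v - delta_mx i 0; pose N : 'M[K]_m.+1 := u *m delta_mx 0 i.
have ui : u i 0 = 0 by rewrite !mxE vi !eqxx subrr.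
have NE j k : N j k = u j 0 *+ (k == i).
  by rewrite mxE big_ord1 !mxE eqxx /= mulr_natr.
clearbody N; have NN : N *m N = 0.
  apply/matrixP => j k; rewrite !mxE big1 // => l _; rewrite !NE.
  have [->|_] := eqVneq l i; first by rewrite ui mul0rn mulr0.
  by rewrite mulr0n mul0r.
have TT : (1%:M + N) *m (1%:M - N) = 1%:M.
  by rewrite mulmxDl !mulmxBr !mul1mx mulmx1 NN subr0 subrK.
have [Tu T'u] := mulmx1_unit TT; have T'T := mulmx1C TT.
pose W := (1%:M - N) *m B *m (1%:M + N).
have BW : char_poly B = char_poly W.
  by apply: (@char_poly_similar _ _ (1%:M - N)) => //;
    rewrite /W -(mulmxA _ (1%:M + N)) TT mulmx1.
have NBE (D : 'M_m.+1) j k : (N *m D) j k = u j 0 * D i k.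
  rewrite mxE (bigD1 i) //= NE eqxx mulr1n big1 ?addr0 // => l li.
  by rewrite NE (negPf li) mulr0n mul0r.
have Wk k : col k W = (1%:M - N) *m (B *m col k (1%:M + N)).
  by rewrite !colE !mulmxA.
clearbody W; have WiE j : W j i = a *+ (j == i).
  have -> : W j i = (col i W) j 0 by rewrite [RHS]mxE.
  rewrite Wk.
  have -> : col i (1%:M + N) = v.
    apply/colP => j'; rewrite !mxE NE eqxx mulr1n !mxE.
    by rewrite andbT addrC subrK.
  rewrite Bv -scalemxAr mulmxBl mul1mx !mxE.
  have -> : \sum_l N j l * v l 0 = u j 0.
    rewrite (bigD1 i) //= NE eqxx vi mulr1n mulr1 big1 ?addr0 // => l li.
    by rewrite NE (negPf li) mulr0n mul0r.
  by rewrite !mxE andbT opprB addrC subrK mulr_natr.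
have Wb j k : k != i -> W j k = B j k - u j 0 * B i k.
  move=> ki; have -> : W j k = (col k W) j 0 by rewrite [RHS]mxE.
  rewrite Wk.
  have -> : col k (1%:M + N) = delta_mx k 0.
    by apply/colP => j'; rewrite !mxE NE (negPf ki) mulr0n addr0 andbT eq_sym.
  by rewrite mulmxA -colE mulmxBl mul1mx mxE mxE [X in _ + X]mxE NBE.
pose B' := row' i (col' i W).
have [|l' [cB' Hl']] := IH (fun j => mu (lift i j)) B' (e *+ 2).
  move=> j k; rewrite /B' 2!mxE Wb ?(eq_sym _ i) ?neq_lift //.
  rewrite -(inj_eq (@lift_inj _ i)) addrAC mulr2n (le_trans (ler_normB _ _)) // lerD // normrM.
  have -> : u (lift i j) 0 = v (lift i j) 0.
    by rewrite !mxE eq_sym (negPf (neq_lift _ _)) subr0.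
  apply: le_trans (_ : 1 * e <= _); last by rewrite mul1r.
  apply: ler_pM => //; have := HB i (lift i k).
  by rewrite (negPf (neq_lift _ _)) mulr0n subr0.
pose l j := if unlift i j is Some j' then l' j' else a.
exists l; split.
  rewrite BW (char_poly_deflate WiE) -/B' cB' (bigD1_ord i) //= /l unlift_none.
  by congr (_ * _); apply: eq_bigr => j _; rewrite liftK.
(* Row i of B v = a v, with v_i = 1 and |v_j| <= 1, bounds a - mu_i by a sum of m+1 entry errors. *)
have amu : `|a - mu i| <= m.+1%:R * e.
  have : (B *m v) i 0 = (a *: v) i 0 by rewrite Bv.
  rewrite !mxE vi mulr1 => <-.
  have -> : \sum_j B i j * v j 0 - mu i = \sum_j (B i j - mu i *+ (i == j)) * v j 0.
    rewrite [RHS](eq_bigr (fun j => B i j * v j 0 - (mu i *+ (i == j)) * v j 0)); last first.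
      by move=> j _; rewrite mulrBl.
    rewrite sumrB; congr (_ - _); rewrite (bigD1 i) //= eqxx vi mulr1 big1 ?addr0 // => j ji.
    by rewrite eq_sym (negPf ji) mulr0n mul0r.
  rewrite (le_trans (ler_norm_sum _ _ _)) //.
  apply: (@le_trans _ _ (\sum_(j < m.+1) e)); last by rewrite sumr_const card_ord mulr_natl.
  by apply: ler_sum => j _; rewrite normrM -[leRHS]mulr1 ler_pM.
(* The constant absorbs the doubled error of the smaller block, 2 m 2^m <= (m+1) 2^(m+1), and also
   the factor m+1 for the split-off eigenvalue. *)
move=> j; rewrite /l; case: unliftP => [j' ->|->].
  rewrite (le_trans (Hl' j')) // -[e *+ 2]mulr_natl mulrA -natrM ler_wpM2r // ler_nat.
  by rewrite expnSr mulnA leq_mul2r leq_mul2r leqnSn !orbT.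
rewrite (le_trans amu) // ler_wpM2r // ler_nat -{1}(muln1 m.+1).
by rewrite leq_mul2l expn_gt0.
Qed.

(** * Block-diagonal diagonalisation *)

Lemma char_poly_diag (K : fieldType) (m : nat) (d : 'rV[K]_m) :
  char_poly (diag_mx d) = \prod_j ('X - (d 0 j)%:P).
Proof.
rewrite char_poly_trig ?diag_mx_is_trig//.
by apply: eq_bigr => j _; rewrite mxE eqxx mulr1n.
Qed.

Lemma block_diagonalP (K : fieldType) (m : nat) (P : rel 'I_m) (X : 'M[K]_m) :
  block_diagonal P X <-> forall i j, ~~ P i j -> X i j = 0.
Proof.
split=> [-> i j /negPf Pij|H]; first by rewrite mxE Pij.
by apply/matrixP => i j; rewrite mxE; case: ifPn => // /H.
Qed.

Section DiagBlocks.
Context {K : fieldType} {m : nat} {P : rel 'I_m}.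
Context (P_equiv : equivalence_rel P).
Implicit Types (X Y : 'M[K]_m) (i j k : 'I_m).

Local Notation cls i := [set j | P i j]%SET.

Lemma cls_notin i j k : j \in cls i -> k \notin cls i -> ~~ P j k /\ ~~ P k j.
Proof.
have Psym := (equivalence_relP P).1 P_equiv; case: Psym => Prefl Ptr.
rewrite !inE => ij; rewrite (Ptr _ _ ij) => nik; split=> //.
by apply: contra nik => kj; rewrite -(Ptr _ _ kj).
Qed.

Lemma diag_block_mull i X Y : block_diagonal P X ->
  diag_block (cls i) (X *m Y) = diag_block (cls i) X *m diag_block (cls i) Y.
Proof.
move=> /block_diagonalP HX; apply/matrixP => a b; rewrite !mxE.
rewrite (bigID (mem (cls i))) /= [X in _ + X]big1 ?addr0.
  by rewrite big_enum_val /=; apply: eq_bigr => c _; rewrite !mxE.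
by move=> k ki; rewrite HX ?mul0r//; have [] := cls_notin (enum_valP a) ki.
Qed.

Lemma diag_block_mulr i X Y : block_diagonal P Y ->
  diag_block (cls i) (X *m Y) = diag_block (cls i) X *m diag_block (cls i) Y.
Proof.
move=> /block_diagonalP HY; apply/matrixP => a b; rewrite !mxE.
rewrite (bigID (mem (cls i))) /= [X in _ + X]big1 ?addr0.
  by rewrite big_enum_val /=; apply: eq_bigr => c _; rewrite !mxE.
by move=> k ki; rewrite HY ?mulr0//; have [] := cls_notin (enum_valP b) ki.
Qed.

(** Restriction to a class is multiplicative as soon as one factor is block-diagonal. So the block
    of M is invertible and conjugates the block of L to the diagonal matrix of the d_j with j in the
    class. *)
Lemma char_poly_diag_block i (L M : 'M[K]_m) (d : 'rV[K]_m) :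
  M \in unitmx -> block_diagonal P M -> L *m M = M *m diag_mx d ->
  char_poly (diag_block (cls i) L) = \prod_(j in cls i) ('X - (d 0 j)%:P).
Proof.
move=> Mu Mb LM.
have dMu : diag_block (cls i) M \in unitmx.
  have : diag_block (cls i) M *m diag_block (cls i) (invmx M) = 1%:M.
    rewrite -diag_block_mull // mulmxV //; apply/matrixP => a b.
    by rewrite !mxE (inj_eq enum_val_inj).
  by move/mulmx1_unit => [].
have -> : char_poly (diag_block (cls i) L) =
  char_poly (diag_mx (\row_a d 0 (enum_val a)) : 'M_#|cls i|).
  apply/esym/(char_poly_similar dMu); rewrite -diag_block_mulr // LM diag_block_mull //.
  congr (_ *m _); apply/matrixP => a b; rewrite !mxE (inj_eq enum_val_inj).
  by [].
rewrite char_poly_diag [RHS]big_enum_val /=.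
by apply: eq_bigr => a _; rewrite mxE.
Qed.

Lemma distinct_eigenvalues_inj i (L : 'M[K]_m) (d : 'I_m -> K) :
  char_poly (diag_block (cls i) L) = \prod_(j in cls i) ('X - (d j)%:P) ->
  distinct_eigenvalues (diag_block (cls i) L) <-> {in cls i &, injective d}.
Proof.
move=> cL; have E : char_poly (diag_block (cls i) L)
    = \prod_(a <- [seq d j | j in cls i]) ('X - a%:P).
  by rewrite cL big_map big_enum.
rewrite /distinct_eigenvalues E; split=> [[s su /prod_XsubC_eq /perm_uniq]|dinj].
  by rewrite su => u; apply/dinjectiveP.
by exists [seq d j | j in cls i] => //; apply/dinjectiveP.
Qed.

End DiagBlocks.

(** A block-diagonal L commutes with a diagonal matrix whose entries tell the classes apart. The two
    are diagonalised simultaneously, and the common eigenvectors are then sorted into the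
    classes. *)
Lemma block_diagonaliser (K : numFieldType) (m : nat) (P : rel 'I_m) (L : 'M[K]_m) :
  equivalence_rel P -> block_diagonal P L -> diagonalizable L ->
  exists M d, [/\ M \in unitmx, block_diagonal P M & L *m M = M *m diag_mx d].
Proof.
move=> Pe /block_diagonalP Lb Ld.
have [Prefl Ptr] := (equivalence_relP P).1 Pe.
(* [g] numbers each class by a canonical representative; characteristic zero keeps the numbers of
   different classes distinct. *)
pose g := \row_j (val (choose (P j) j))%:R : 'rV[K]_m.
have gE j k : (g 0 j == g 0 k) = P j k.
  rewrite !mxE eqr_nat; apply/eqP/idP => [/val_inj E|Pjk].
    have := chooseP (Prefl j); rewrite E => H1.
    by rewrite (Ptr _ _ H1) -(Ptr _ _ (chooseP (Prefl k))) Prefl.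
  congr val; rewrite (eq_choose (Q := P k)) => [|l]; last exact: Ptr.
  by apply: choose_id => //; rewrite -(Ptr _ _ Pjk).
have cLG : comm_mx L (diag_mx g).
  rewrite /comm_mx; apply/matrixP => j k; rewrite mul_mx_diag mul_diag_mx !mxE mulrC.
  case Pjk: (P j k); last by rewrite Lb ?Pjk// !mulr0.
  by move: Pjk; rewrite -gE !mxE => /eqP ->.
have [Q Qu] : codiagonalizable [:: L; diag_mx g].
  apply/codiagonalizableP; split.
    move=> A B; rewrite !inE => /orP[]/eqP-> /orP[]/eqP-> //; exact/esym.
  move=> A; rewrite !inE => /orP[/eqP->//|/eqP->]; exact: diagonalizable_diag.
rewrite /= andbT => /andP[/similar_diagPex[d1 /(similarP Qu) QL]
  /similar_diagPex[d2 /(similarP Qu) QG]].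
pose N := invmx Q; have Nu : N \in unitmx by rewrite unitmx_inv.
have conjN X d : Q *m X = diag_mx d *m Q -> X *m N = N *m diag_mx d.
  move=> E; apply: (can_inj (mulKmx Qu)); rewrite mulmxA E -mulmxA mulmxV // mulmx1.
  by rewrite mulKVmx.
have NL := conjN _ _ QL; have NG := conjN _ _ QG.
(* Each column of [N] is an eigenvector of [diag_mx g], hence supported on one class. Comparing
   characteristic polynomials, [d2] is a permutation of [g], and [s] puts the columns into the
   positions of their classes. *)
have [s gs] : exists s : perm.perm_of 'I_m, forall j, g 0 j = d2 0 (perm.fun_of_perm s j).
  have : perm_eq [tuple g 0 j | j < m] [tuple d2 0 j | j < m].
    have pE (d : 'rV[K]_m) : \prod_(a <- [tuple d 0 j | j < m]) ('X - a%:P) =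
      char_poly (diag_mx d).
      by rewrite char_poly_diag big_tuple; apply: eq_bigr => j _; rewrite tnth_mktuple.
    by apply: prod_XsubC_eq; rewrite !pE; exact: char_poly_similar QG.
  move=> /perm.tuple_permP[s /val_inj E]; exists s => j.
  by have := congr1 (fun t => tnth t j) E; rewrite !tnth_mktuple.
exists (col_perm s N), (\row_j d1 0 (perm.fun_of_perm s j)); split.
- by rewrite col_permE unitmx_mul Nu unitmx_perm.
- apply/block_diagonalP => i j nP; rewrite mxE.
  have /matrixP/(_ i (perm.fun_of_perm s j)) := NG.
  rewrite mul_mx_diag mul_diag_mx [LHS]mxE [RHS]mxE -gs mulrC => /eqP.
  rewrite -subr_eq0 -mulrBr mulf_eq0 subr_eq0 gE (negPf nP) orbF.
  by move/eqP.
- apply/matrixP => i j; have /matrixP/(_ i (perm.fun_of_perm s j)) := NL.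
  rewrite !mul_mx_diag !mxE => <-; apply: eq_bigr => k _; by rewrite !mxE.
Qed.

(** * The normal form given by the scheme *)

Section Scheme.
Context {R : realType} {m : nat}.
Local Notation C := R[i].
Implicit Types (d : scheme R m) (eg : nat -> 'rV[C]_m).

Lemma partP d l i j :
  reflect (forall k, (k < l)%N -> eigs d k 0 i = eigs d k 0 j) (part d l i j).
Proof.
apply: (iffP forallP) => [H k kl|H k]; first exact/eqP/(H (Ordinal kl)).
exact/eqP/H.
Qed.

Lemma part_equiv d l : equivalence_rel (part d l).
Proof.
apply/equivalence_relP; split=> [i|i j /partP ij k]; first exact/partP.
by apply/partP/partP => H k' kl; rewrite -H // ij.
Qed.

(** For [k < l], Lambda_k is scalar on every class of Pi_(l-1). *)
Lemma block_diagonal_comm d l k (X : 'M[C]_m) : block_diagonal (part d l) X ->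
  (k < l)%N -> diag_mx (eigs d k) *m X = X *m diag_mx (eigs d k).
Proof.
move=> /block_diagonalP HX kl; apply/matrixP => i j.
rewrite mul_diag_mx mul_mx_diag !mxE mulrC.
have [/partP ->//|/HX ->] := boolP (part d l i j); by rewrite !mul0r.
Qed.

(** It takes a sequence of rows instead of a scheme, so that the eigenvalues of the last matrix,
    obtained outside the scheme, can be appended. *)
Definition diag_part eg (k : nat) (x : R) : 'M[C]_m :=
  \sum_(j < k) x%:C ^+ j *: diag_mx (eg j).

Lemma diag_partS eg k x :
  diag_part eg k.+1 x = diag_part eg k x + x%:C ^+ k *: diag_mx (eg k).
Proof. by rewrite /diag_part big_ord_recr. Qed.

Lemma mx_isO_diag_part_tail eg l k (K : 'M[C]_m) :
  (forall j, (j < l)%N -> diag_mx (eg j) *m K = K *m diag_mx (eg j)) -> (l <= k)%N ->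
  mx_isO l.+1 (fun x => diag_part eg k.+1 x *m K - K *m diag_part eg k.+1 x
                 - x%:C ^+ l *: (diag_mx (eg l) *m K - K *m diag_mx (eg l))).
Proof.
move=> Kc lk; pose br j := diag_mx (eg j) *m K - K *m diag_mx (eg j).
apply: (mx_isO_ext (F := fun x =>
  \sum_(j < k.+1 | j != Ordinal (lk : l < k.+1)%N) x%:C ^+ j *: br j)).
  move=> x; rewrite /diag_part mulmx_suml mulmx_sumr -sumrB.
  rewrite [in RHS](bigD1 (Ordinal (lk : l < k.+1)%N)) //= -scalemxAl -scalemxAr.
  rewrite -scalerBr addrAC subrr add0r; apply: eq_bigr => j _.
  by rewrite -scalemxAl -scalemxAr -scalerBr.
apply: mx_isO_sum => j jl; case: (ltngtP j l) => jl'.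
- rewrite /br Kc // subrr; apply: mx_isO_ext (mx_isO_le _ (mx_isO_X (l.+1)
  (mx_isO_cst 0))); rewrite ?addn0//.
  by move=> x; rewrite !scaler0.
- by apply: mx_isO_le (mx_isO_X j (mx_isO_cst (br j))); rewrite addn0.
- by move: jl; rewrite -val_eqE /= jl' eqxx.
Qed.

(* One factor [1 + x^(k+1-l) K_l] removes the part of the x^(k+1)-coefficient
   outside the classes of Pi_l: the lower Lambda_j commute with K_l, so
   [D, K_l] = x^l [Lambda_l, K_l] + O(x^(l+1)). *)
Lemma correction_step eg l k (X Y K : 'M[C]_m) :
  (forall j, (j < l)%N -> diag_mx (eg j) *m K = K *m diag_mx (eg j)) -> (l <= k)%N ->
  (diag_mx (eg l) *m K - K *m diag_mx (eg l)) + X - Y = 0 ->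
  mx_isO k.+2 (fun x =>
    (diag_part eg k.+1 x + x%:C ^+ k.+1 *: X) *m (1%:M + x%:C ^+ (k.+1 - l) *: K)
    - (1%:M + x%:C ^+ (k.+1 - l) *: K) *m (diag_part eg k.+1 x + x%:C ^+ k.+1 *: Y)).
Proof.
move=> Kc lk E.
have kl : (k.+1 - l + l.+1 = k.+2)%N by rewrite addnS subnK // leqW.
have O1 := mx_isO_X (k.+1 - l) (mx_isO_diag_part_tail Kc lk); rewrite kl in O1.
have O2 := mx_isO_X (k.+1 - l) (mx_isO_X k.+1 (mx_isO_cst (X *m K - K *m Y))).
have O2' : mx_isO k.+2 (fun x => x%:C ^+ (k.+1 - l) *: (x%:C ^+ k.+1 *: (X *m K - K *m Y))).
  apply: mx_isO_le O2; rewrite addn0 subSn // addSn ltnS; exact: leq_addl.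
apply: mx_isO_ext (mx_isO_D O1 O2') => x.
have xl : x%:C ^+ k.+1 = x%:C ^+ (k.+1 - l) * x%:C ^+ l by rewrite -exprD subnK // leqW.
have {}E : Y = (diag_mx (eg l) *m K - K *m diag_mx (eg l)) + X by apply/esym/eqP;
  rewrite -subr_eq0 E.
set y := x%:C ^+ (k.+1 - l); set D := diag_part _ _ _; set br := _ - _ in E *.
rewrite !(mulmxDl, mulmxDr) !mul1mx !mulmx1 -!scalemxAl -!scalemxAr.
rewrite [in x%:C ^+ k.+1 *: Y]E !scalerDr.
rewrite -/br xl -/y -!scalerA.
apply/matrixP => i j; rewrite !mxE; ring.
Qed.

Lemma mx_expands_corr_prod d k l :
  mx_expands (fun x : R => \prod_(j < l) (1%:M + x%:C ^+ (k.+1 - j) *: corr d k j)).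
Proof.
elim: l => [|l IH].
  by move=> i j N; apply: expands_to_ext (mx_expands_cst 1%:M i j N) => x; rewrite big_ord0.
move=> i j N; apply: expands_to_ext (_ : expands_to N (fun x : R =>
  ((\prod_(j < l) (1%:M + x%:C ^+ (k.+1 - j) *: corr d k j)) *m
   (1%:M + x%:C ^+ (k.+1 - l) *: corr d k l)) i j)) => [x|].
  by rewrite big_ord_recr.
apply: (mx_expands_M IH); apply: mx_expands_D; first exact: mx_expands_cst.
by apply: mx_expands_Z (mx_expands_cst _); exact: expandsX.
Qed.

(** Telescoping over the factors: if T is the next one, B S T - S T D' = (B S - S D) T + S (D T - T
    D'). The first term is the induction hypothesis, the second is [correction_step]. *)
Lemma corrections_step d k l (B : R -> 'M[C]_m) :
  corrections d k -> (l <= k.+1)%N ->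
  mx_isO k.+2 (fun x => B x - (diag_part (eigs d) k.+1 x + x%:C ^+ k.+1 *: refined d k 0)) ->
  let S x := \prod_(j < l) (1%:M + x%:C ^+ (k.+1 - j) *: corr d k j) in
  mx_isO k.+2 (fun x => B x *m S x
    - S x *m (diag_part (eigs d) k.+1 x + x%:C ^+ k.+1 *: refined d k l)).
Proof.
move=> cor + OB; elim: l => [_|l IH lk] /=.
  by apply: mx_isO_ext OB => x; rewrite big_ord0 mulmx1 mul1mx.
have [E Kb _] := cor l lk.
have O1 := IH (ltnW lk).
have O2 := correction_step (fun j jl => block_diagonal_comm Kb jl) lk E.
have FT : mx_expands (fun x : R => 1%:M + x%:C ^+ (k.+1 - l) *: corr d k l).
  by apply: mx_expands_D; [exact: mx_expands_cst|apply: mx_expands_Z (mx_expands_cst _);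
    exact: expandsX].
have O1T := mx_isO_M O1 (mx_expands_mO0 FT); rewrite addn0 in O1T.
have FS := mx_expands_corr_prod d k l.
have SO2 := mx_isO_M (mx_expands_mO0 FS) O2; rewrite add0n in SO2.
apply: mx_isO_ext (mx_isO_D O1T SO2) => x; rewrite big_ord_recr /= -mulmxE.
rewrite mulmxBl mulmxBr !mulmxA; set a := _ *m _ *m _; set b := _ *m _ *m _.
by rewrite addrA subrK.
Qed.

(** For [M := diagzr d k.+1] this is [transfo d k]. Leaving [M] free lets the last step use a
    diagonaliser found separately. *)
Definition change_basis d k (M : 'M[C]_m) (x : R) : 'M[C]_m :=
  (\prod_(l < k.+1) (1%:M + x%:C ^+ (k.+1 - l) *: corr d k l)) *m M.

Lemma mx_expands_change_basis d k M : mx_expands (change_basis d k M).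
Proof. exact: mx_expands_M (mx_expands_corr_prod d k k.+1) (mx_expands_cst M). Qed.

(** The exponents k+1-l with l <= k are positive, so every factor is the identity at 0. *)
Lemma change_basis0 d k M : change_basis d k M 0 = M.
Proof.
rewrite /change_basis big1 ?mul1mx// => l _.
by rewrite raddf0 subSn ?expr0n ?scale0r ?addr0// -ltnS.
Qed.

Lemma change_basis_step d k (B : R -> 'M[C]_m) M (lam : 'rV[C]_m) :
  corrections d k ->
  mx_isO k.+2 (fun x => B x - (diag_part (eigs d) k.+1 x + x%:C ^+ k.+1 *: refined d k 0)) ->
  block_diagonal (part d k.+1) M -> refined d k k.+1 *m M = M *m diag_mx lam ->
  mx_isO k.+2 (fun x => B x *m change_basis d k M x
    - change_basis d k M x *m (diag_part (eigs d) k.+1 x + x%:C ^+ k.+1 *: diag_mx lam)).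
Proof.
move=> cor OB Mb XM.
have O1 := mx_isO_M (corrections_step cor (leqnn _) OB) (mx_isO_cst M); rewrite addn0 in O1.
apply: mx_isO_ext O1 => x; rewrite /change_basis; set S := \prod_(j < _) _.
rewrite mulmxBl -!mulmxA; congr (_ - S *m _).
rewrite mulmxDl mulmxDr -scalemxAl XM -scalemxAr; congr (_ + _).
rewrite /diag_part mulmx_suml mulmx_sumr; apply: eq_bigr => j _.
by rewrite -scalemxAl -scalemxAr (block_diagonal_comm Mb).
Qed.

(** * Iteration of the steps and the last diagonalisation *)

Lemma conjugate_mx_isO N (B S D : R -> 'M[C]_m) :
  mx_expands S -> S 0 \in unitmx -> mx_isO N (fun x => B x *m S x - S x *m D x) ->
  mx_isO N (fun x => invmx (S x) *m B x *m S x - D x).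
Proof.
move=> FS S0 OS; have := mx_isO_M (mx_expands_mO0 (mx_expands_inv FS S0)) OS; rewrite add0n.
apply: mx_isO_near; have := near_unitmx FS S0; apply: filterS => x Su.
by rewrite mulmxBr !mulmxA mulVmx// mul1mx.
Qed.

Lemma intertwine_conj (A T B S : 'M[C]_m) : S \in unitmx -> A *m T = T *m B ->
  A *m (T *m S) = T *m S *m (invmx S *m B *m S).
Proof. by move=> Su AT; rewrite !mulmxA mulmxK// AT. Qed.

Lemma coefs_leading d k (B : R -> 'M[C]_m) (Bc : nat -> 'M[C]_m) :
  full_expansion B Bc -> mx_isO k.+1 (fun x => B x - diag_part (eigs d) k.+1 x) ->
  forall j, (j <= k)%N -> Bc j = diag_mx (eigs d j).
Proof.
move=> /full_expansionP FB OB l lk; apply/matrixP => i j.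
have O2 : isO k.+1 (fun x => B x i j - (\poly_(l < k.+1) diag_mx (eigs d l) i j).[x%:C]).
  by apply: isO_ext (OB i j) => x;
    rewrite !mxE /diag_part (expansion_entry (fun l => diag_mx (eigs d l))).
have := isO_poly_uniq (FB i j k.+1) O2 (lk : (l < k.+1)%N).
by rewrite !coef_poly ltnS lk.
Qed.

Lemma leading_coefs d k (B : R -> 'M[C]_m) (Bc : nat -> 'M[C]_m) :
  full_expansion B Bc -> (forall j, (j <= k)%N -> Bc j = diag_mx (eigs d j)) ->
  mx_isO k.+2 (fun x => B x - (diag_part (eigs d) k.+1 x + x%:C ^+ k.+1 *: Bc k.+1)).
Proof.
move=> FB HB; have /matrix_bigO_powP := FB k.+1.
apply: mx_isO_ext => x; rewrite big_ord_recr /=; congr (_ - (_ + _)).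
by apply: eq_bigr => j _; rewrite HB // -ltnS.
Qed.

Lemma full_expansion_at0 (F : R -> 'M[C]_m) Fc : full_expansion F Fc -> F 0 = Fc 0%N.
Proof.
move=> /full_expansionP H; apply/matrixP => i j.
have := isO_at0 (H i j 1%N); rewrite horner_poly big_ord1 expr0 mulr1 => /eqP.
by rewrite subr_eq0 => /eqP.
Qed.

(** [scheme_until] only asserts that [coefs d k] expands the k-th transformed family. That its first
    k+1 coefficients are Lambda_0, ..., Lambda_k follows inductively: [change_basis_step] exhibits
    these leading terms, and coefficients of an expansion are unique. *)
Lemma scheme_coefs (A : R -> 'M[C]_m) Ac d n :
  full_expansion A Ac -> scheme_until A (Ac 0%N) d n -> forall k, (k < n)%N ->
  (forall j, (j <= k)%N -> coefs d k j = diag_mx (eigs d j)) /\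
  exists T : R -> 'M[C]_m, [/\ mx_expands T, T 0 \in unitmx &
    \forall x \near (0 : R), A x *m T x = T x *m transformed A d k x].
Proof.
move=> FA sch; elim=> [|k IH] kn.
  have [[M0u _ M0 _] FB _] := sch _ kn; split.
    move=> [] // _; rewrite -(full_expansion_at0 FB) /= (full_expansion_at0 FA).
    exact: M0.
  exists (fun=> diagzr d 0); split=> //; first exact: mx_expands_cst.
  by near=> x; rewrite !mulmxA mulmxV// mul1mx.
have [cf [T [FT T0 AT]]] := IH (ltnW kn).
have [_ FB cor] := sch _ (ltnW kn); have [[Mu Mb LM _] FB' _] := sch _ kn.
have XM : refined d k k.+1 *m diagzr d k.+1 = diagzr d k.+1 *m diag_mx (eigs d k.+1).
  by rewrite -LM !mulmxA mulmxV// mul1mx.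
have OS := change_basis_step cor (leading_coefs FB cf) Mb XM.
have FS := mx_expands_change_basis d k (diagzr d k.+1).
have S0 : change_basis d k (diagzr d k.+1) 0 \in unitmx by rewrite change_basis0.
split.
  apply: (coefs_leading FB'); apply: mx_isO_ext (conjugate_mx_isO FS S0 OS) => x.
  by rewrite [in RHS]diag_partS.
exists (fun x => T x *m change_basis d k (diagzr d k.+1) x); split.
- exact: mx_expands_M.
- by rewrite change_basis0 unitmx_mul T0.
have tE x : transformed A d k.+1 x = invmx (change_basis d k (diagzr d k.+1) x)
    *m transformed A d k x *m change_basis d k (diagzr d k.+1) x by [].
have Su := near_unitmx FS S0.
near=> x; rewrite tE; apply: intertwine_conj; by near: x.
Unshelve. all: by end_near. Qed.

(* The last index n is treated separately since the scheme does not record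
   a diagonaliser of the last matrix: its eigenvalues are [eg n]. *)
Lemma normal_form (A : R -> 'M[C]_m) Ac d n :
  full_expansion A Ac -> assumption_A A (Ac 0%N) d n ->
  nondegenerate_blocks (Ac 0%N) d n ->
  exists eg (T B : R -> 'M[C]_m),
    [/\ mx_expands T /\ T 0 \in unitmx, mx_expands B /\ mx_isO n.+1 (fun x =>
      B x - diag_part eg n.+1 x),
        \forall x \near (0 : R), A x *m T x = T x *m B x,
        (forall k, (k < n)%N -> eg k = eigs d k)
      & forall i j, i != j -> exists2 k, (k <= n)%N & eg k 0 i != eg k 0 j].
Proof.
move=> FA [sch dia] nd.
have Lb : block_diagonal (part d n) (tLambda (Ac 0%N) d n).
  apply/block_diagonalP => i j; case: n {sch dia nd} => [|n].
    by move=> /negP[]; apply/partP => k; rewrite ltn0.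
  by move=> /negPf nij; rewrite mxE nij.
have [M [lam [Mu Mb LM]]] := block_diagonaliser (part_equiv d n) Lb (dia n (leqnn n)).
pose eg k := if (k < n)%N then eigs d k else lam.
have eg_lt k : (k < n)%N -> eg k = eigs d k by rewrite /eg => ->.
have egn : eg n = lam by rewrite /eg ltnn.
(* Indices in different classes are separated by an earlier Lambda_k, those in one class by the last
   eigenvalues, which non-degeneracy makes distinct there. *)
have eg_inj i j : i != j -> exists2 k, (k <= n)%N & eg k 0 i != eg k 0 j.
  move=> ij; have [/partP pij|] := boolP (part d n i j); last first.
    rewrite negb_forall => /existsP[k Hk]; exists (k : nat); first exact/ltnW/ltn_ord.
    by rewrite eg_lt ?ltn_ord.
  exists n => //; rewrite egn; apply: contraNneq ij => lij; apply/eqP.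
  have /(distinct_eigenvalues_inj (char_poly_diag_block (part_equiv d n) i Mu Mb LM)) := nd i.
  by apply=> //; rewrite inE; apply/partP.
have dpE k x : (k <= n)%N -> diag_part eg k x = diag_part (eigs d) k x.
  by move=> kn; apply: eq_bigr => j _; rewrite eg_lt // (leq_trans (ltn_ord j)).
have FAm := full_expansion_mx_expands FA.
(* For n = 0 no step of the scheme is available, and A is conjugated by the constant [M] that
   diagonalises A_0. *)
case: n => [|n] in sch dia nd Lb Mb LM eg eg_lt egn eg_inj dpE *.
  exists eg, (fun=> M), (fun x => invmx M *m A x *m M); split=> //.
  - by split=> //; exact: mx_expands_cst.
  - split; first by apply: mx_expands_M (mx_expands_cst M); apply: mx_expands_M FAm;
    exact: mx_expands_cst.
    have OA : mx_isO 1 (fun x => A x *m M - M *m diag_mx lam).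
      have /matrix_bigO_powP H := FA 0%N.
      apply: mx_isO_ext (mx_isO_M H (mx_isO_cst M)) => x.
      by rewrite big_ord1 expr0 scale1r mulmxBl -LM.
    apply: mx_isO_ext (conjugate_mx_isO (mx_expands_cst M) Mu OA) => x.
    by rewrite diag_partS egn /diag_part big_ord0 add0r expr0 scale1r.
  - by near=> x; rewrite !mulmxA mulmxV// mul1mx.
have [cf [T [FT T0 AT]]] := scheme_coefs FA sch (ltnSn n).
have [_ FB cor] := sch _ (ltnSn n).
have OS := change_basis_step cor (leading_coefs FB cf) Mb LM.
have FS := mx_expands_change_basis d n M.
have S0 : change_basis d n M 0 \in unitmx by rewrite change_basis0.
exists eg, (fun x => T x *m change_basis d n M x),
  (fun x => invmx (change_basis d n M x) *m transformed A d n x *m change_basis d n M x).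
split=> //.
- by split; [exact: mx_expands_M|rewrite change_basis0 unitmx_mul T0].
- split.
    exact: mx_expands_M (mx_expands_M (mx_expands_inv FS S0) (full_expansion_mx_expands FB)) FS.
  by apply: mx_isO_ext (conjugate_mx_isO FS S0 OS) => x; rewrite [in RHS]diag_partS egn dpE.
have Su := near_unitmx FS S0.
near=> x; apply: intertwine_conj; by near: x.
Unshelve. all: by end_near. Qed.

(* By minimality of n the partition Pi_(n-1) is not discrete. *)
Lemma coinciding_pair (A : R -> 'M[C]_m) A0 d n :
  assumption_A A A0 d n.+1 -> ~ nondegenerate_blocks A0 d n ->
  exists i j : 'I_m, i != j /\ part d n.+1 i j.
Proof.
move=> [sch _] nd; apply: contrapT => H; apply: nd => i.
have [[Mu Mb LM _] _ _] := sch n (ltnSn n).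
have {}LM : tLambda A0 d n *m diagzr d n = diagzr d n *m diag_mx (eigs d n).
  by rewrite -LM !mulmxA mulmxV// mul1mx.
apply/(distinct_eigenvalues_inj (char_poly_diag_block (part_equiv d n) i Mu Mb LM)).
move=> j k; rewrite !inE => /partP ij /partP ik jk.
apply: contrapT => /eqP njk; apply: H; exists j, k; split=> //.
apply/partP => l; rewrite ltnS leq_eqVlt => /orP[/eqP->//|ln].
by rewrite -ij // ik.
Qed.

End Scheme.

(** * Eigenvalues and eigenvectors *)

Section Spectrum.
Context {R : realType} {m : nat}.
Local Notation C := R[i].

(** * Separation of the leading polynomials *)

Lemma poly_lowest_term (p : {poly C}) n k : (size p <= n.+1)%N -> p`_k != 0 ->
  exists d q r, [/\ (d <= n)%N, q != 0 & p = (q%:P + r * 'X) * 'X^d].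
Proof.
move=> sp pk; have p0 : p != 0 by apply: contraNneq pk => ->; rewrite coef0.
have [d [q]] := multiplicity_XsubC p 0; rewrite p0 /= subr0 => q0 pE.
have [r rE] : exists r, q - q.[0]%:P = r * 'X by apply: polyX_mulE; rewrite !hornerE subrr.
exists d, q.[0], r; split=> //; last by rewrite -rE addrC subrK.
have qn0 : q != 0 by apply: contraNneq q0 => ->; rewrite root0.
rewrite -ltnS; apply: leq_trans sp; rewrite pE size_mulXn // -addn1 ?(addnC (size q)).
by rewrite leq_add2l lt0n size_poly_eq0.
Qed.

Lemma poly_gap (p : {poly C}) n k K : (size p <= n.+1)%N -> p`_k != 0 -> 0 <= K ->
  \forall x \near (0 : R), x != 0 -> K * `|x%:C| ^+ n.+1 < `|p.[x%:C]|.
Proof.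
move=> sp pk K0; have [d [q [r [dn q0 ->]]]] := poly_lowest_term sp pk.
have e0 : 0 < `|q| / 2 by rewrite divr_gt0// normr_gt0.
(* For |x| below this bound, K|x| < (K+1)|x| <= |q|/2; the added 1 gives strictness and a positive
   denominator. *)
have f0 : 0 < `|q| / 2 / (K + 1) by rewrite divr_gt0// ltr_wpDl.
have Fp : expands (fun x : R => (q%:P + r * 'X).[x%:C]) := expands_poly _.
have away := expands_away Fp; rewrite /= raddf0 hornerD hornerMX hornerC mulr0 addr0 in away.
have {}away := away q0.
near=> x => x0; have nx : 0 < `|x%:C| by rewrite normr_gt0 fmorph_eq0.
rewrite hornerM hornerXn normrM normrX.
have H1 : `|q| / 2 <= `|(q%:P + r * 'X).[x%:C]| by near: x.
have H2 : `|x%:C| <= `|q| / 2 / (K + 1) by near: x; exact: near0_small.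
have H3 : `|x%:C| <= 1 by near: x; exact: near0_small.
apply: (@lt_le_trans _ _ (`|q| / 2 * `|x%:C| ^+ d)); last by rewrite ler_wpM2r ?exprn_ge0.
apply: (@lt_le_trans _ _ (`|q| / 2 * `|x%:C| ^+ n)); last first.
  by rewrite ler_wpM2l ?(ltW e0)// ler_wiXn2l.
rewrite exprS mulrA ltr_pM2r ?exprn_gt0//.
apply: (@lt_le_trans _ _ ((K + 1) * `|x%:C|)); first by rewrite ltr_pM2r// ltrDl.
by rewrite mulrC -ler_pdivlMr// ltr_wpDl.
Unshelve. all: by end_near. Qed.

Context {eg : nat -> 'rV[C]_m} {n : nat}.
Context (eg_sep : forall i j, i != j -> exists2 k, (k <= n)%N & eg k 0 i != eg k 0 j).

Definition leading_poly (i : 'I_m) : {poly C} := \poly_(k < n.+1) eg k 0 i.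
Local Notation mu i x := (leading_poly i).[x%:C].

Lemma diag_part_entry (x : R) i j : diag_part eg n.+1 x i j = mu i x *+ (i == j).
Proof.
rewrite /diag_part (expansion_entry (fun k => diag_mx (eg k))).
rewrite !horner_poly -sumrMnl; apply: eq_bigr => k _; rewrite mxE.
by case: eqP; rewrite ?mulr0n ?mul0r.
Qed.

Lemma leading_poly_diff i j : i != j ->
  (size (leading_poly i - leading_poly j)%R <= n.+1)%N /\
  exists k, (leading_poly i - leading_poly j)`_k != 0.
Proof.
move=> ij; split.
  by rewrite (leq_trans (size_polyD _ _))// size_polyN geq_max !size_poly.
have [k kn ek] := eg_sep ij; exists k.
by rewrite coefB !coef_poly ltnS kn subr_eq0.
Qed.

Lemma leading_gap K : 0 <= K -> \forall x \near (0 : R), x != 0 ->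
  forall i j, i != j -> K * `|x%:C| ^+ n.+1 < `|mu i x - mu j x|.
Proof.
move=> K0; have H (p : 'I_m * 'I_m) : \forall x \near (0 : R), x != 0 ->
    p.1 != p.2 -> K * `|x%:C| ^+ n.+1 < `|mu p.1 x - mu p.2 x|.
  have [->|ij] := eqVneq p.1 p.2; first by near=> x; rewrite ?eqxx.
  have [sp [k pk]] := leading_poly_diff ij; have := poly_gap sp pk K0.
  by apply: filterS => x H x0 _; have := H x0; rewrite hornerD hornerN.
have := near0_forall H; apply: filterS => x Hx x0 i j ij.
exact: (Hx (i, j) x0 ij).
Unshelve. all: by end_near. Qed.

(** * Spectrum of a family with separated leading part *)

Context {B : R -> 'M[C]_m}.
Context (B_expands : mx_expands B).
Context (B_lead : mx_isO n.+1 (fun x => B x - diag_part eg n.+1 x)).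

Lemma eigenvalue_labels : exists (lam : 'I_m -> R -> C) (c : C), 0 <= c /\
  \forall x \near (0 : R), char_poly (B x) = \prod_i ('X - (lam i x)%:P) /\
    (forall i, `|lam i x - mu i x| <= c * `|x%:C| ^+ n.+1) /\
    (forall i j, `|B x i j - mu i x *+ (i == j)| <= c * `|x%:C| ^+ n.+1).
Proof.
have [c c0 Hc] := mx_isO_uniform B_lead.
(* The added 1 makes [K >= 1], so that [K * c] bounds the eigenvalue errors and the entry errors
   alike. *)
pose K := (m * 2 ^ m)%:R + 1 : C; have K0 : 1 <= K by rewrite lerDr.
have H (x : R) : exists l : 'I_m ->
  C, (forall i j, `|B x i j - mu i x *+ (i == j)| <= c * `|x%:C| ^+ n.+1) ->
    char_poly (B x) = \prod_i ('X - (l i)%:P) /\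
    forall i, `|l i - mu i x| <= (m * 2 ^ m)%:R * (c * `|x%:C| ^+ n.+1).
  have [HB|nHB] := boolp.pselect (forall i j,
    `|B x i j - mu i x *+ (i == j)| <= c * `|x%:C| ^+ n.+1).
    by have [l Hl] := eigenvalue_perturbation HB; exists l.
  by exists (fun=> 0) => /nHB.
have {H} [lam Hlam] := boolp.choice H.
exists (fun i x => lam x i), (K * c); split; first by rewrite mulr_ge0// (le_trans ler01).
apply: filterS Hc => x Hx.
have HB i j : `|B x i j - mu i x *+ (i == j)| <= c * `|x%:C| ^+ n.+1.
  by rewrite -diag_part_entry; have := Hx i j; rewrite !mxE.
have [-> Hl] := Hlam x HB; split=> //; split=> [i|i j].
  by rewrite (le_trans (Hl i))// mulrA ler_wpM2r ?exprn_ge0// ler_wpM2r// lerDl.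
by rewrite (le_trans (HB i j))// ler_wpM2r ?exprn_ge0// ler_peMl.
Qed.

(** An eigenvector for lambda_i has its largest entry at some i', and row i' of the equation puts
    lambda_i within m c |x|^(n+1) of mu_i'. The gap then forces i' = i, which justifies the
    normalisation V_ii = 1. *)
Lemma labelled_eigenvectors (lam : 'I_m -> R -> C) (c : C) : 0 <= c ->
  (\forall x \near (0 : R), char_poly (B x) = \prod_i ('X - (lam i x)%:P) /\
    (forall i, `|lam i x - mu i x| <= c * `|x%:C| ^+ n.+1) /\
    (forall i j, `|B x i j - mu i x *+ (i == j)| <= c * `|x%:C| ^+ n.+1)) ->
  exists V : R -> 'M[C]_m, V 0 = 1%:M /\ \forall x \near (0 : R),
    [/\ B x *m V x = V x *m diag_mx (\row_i lam i x), forall i, V x i i = 1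
      & forall i j, `|V x i j| <= 1].
Proof.
move=> c0 Hlam.
pose good x (v : 'M[C]_m) := [/\ B x *m v = v *m diag_mx (\row_i lam i x),
    forall i, v i i = 1 & forall i j, `|v i j| <= 1].
(* The value at 0 is prescribed in the choice: some mu_i(0) may coincide, and then eigenvectors at 0
   are not determined by the equation. *)
have H (x : R) : exists v : 'M[C]_m, (x = 0 -> v = 1%:M) /\ ((exists v', (x = 0 ->
  v' = 1%:M) /\ good x v') -> good x v).
  have [[v [v0 Hv]]|nv] := boolp.pselect (exists v', (x = 0 -> v' = 1%:M) /\ good x v').
    by exists v; split.
  by exists 1%:M; split=> // /nv.
have {H} [V HV] := boolp.choice H.
exists V; split; first exact: (HV 0).1.
(* The part [c] covers lambda_i - mu_i, the part [m c] covers lambda_i - mu_i'. *)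
have K0 : 0 <= c + m%:R * c by rewrite addr_ge0// mulr_ge0.
near=> x; apply: (HV x).2.
have [cB [Hl HB]] : char_poly (B x) = \prod_i ('X - (lam i x)%:P) /\
    (forall i, `|lam i x - mu i x| <= c * `|x%:C| ^+ n.+1) /\
    (forall i j, `|B x i j - mu i x *+ (i == j)| <= c * `|x%:C| ^+ n.+1) by near: x.
have [x0|x0] := eqVneq x 0.
  exists 1%:M; split=> //.
  (* At x = 0 the bounds are zero: B(0) is diagonal with entries lambda_i(0), so the identity
     qualifies. *)
  have H0 (a b : C) : `|a - b| <= c * `|x%:C| ^+ n.+1 -> a = b.
    by rewrite x0 raddf0 normr0 expr0n /= mulr0 normr_le0 subr_eq0 => /eqP.
  split=> [|i|i j]; last 2 first.
  - by rewrite mxE eqxx.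
  - by rewrite mxE; case: eqP; rewrite ?normr1 ?normr0.
  rewrite mulmx1 mul1mx; apply/matrixP => i j.
  by rewrite (H0 _ _ (HB i j)) !mxE -(H0 _ _ (Hl i)); case: eqP => [->|].
have gap i j : i != j -> (c + m%:R * c) * `|x%:C| ^+ n.+1 < `|mu i x - mu j x|.
  move: i j; have : x != 0 by []; near: x; exact: leading_gap.
have Hv i : exists v : 'cV[C]_m, [/\ B x *m v = lam i x *: v, v i 0 = 1 & forall j,
  `|v j 0| <= 1].
  have : root (char_poly (B x)) (lam i x).
    rewrite cB /root horner_prod (bigD1 i) //= hornerXsubC subrr mul0r //.
  move=> /normalised_eigenvector[v [i' [Bv vi' v1]]].
  suff ii' : i = i' by exists v; split; rewrite ?ii'// -ii'.
  apply/eqP; apply: contraT => /gap/lt_geF <-.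
  have -> : mu i x - mu i' x = (lam i x - mu i' x) - (lam i x - mu i x) by ring.
  rewrite (le_trans (ler_normB _ _))// mulrDl addrC lerD//.
  have : (B x *m v) i' 0 = (lam i x *: v) i' 0 by rewrite Bv.
  rewrite !mxE vi' mulr1 => <-.
  have -> : \sum_j B x i' j * v j 0 - mu i' x =
    \sum_j (B x i' j - mu i' x *+ (i' == j)) * v j 0.
    rewrite [RHS](eq_bigr (fun j => B x i' j * v j 0 - (mu i' x *+ (i' == j)) * v j 0));
      last first.
      by move=> j _; rewrite mulrBl.
    rewrite sumrB; congr (_ - _); rewrite (bigD1 i') //= eqxx vi' mulr1 big1 ?addr0 // => j ji.
    by rewrite eq_sym (negPf ji) mulr0n mul0r.
  rewrite (le_trans (ler_norm_sum _ _ _)) //.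
  apply: (@le_trans _ _ (\sum_(j < m) c * `|x%:C| ^+ n.+1)).
    by apply: ler_sum => j _; rewrite normrM -[leRHS]mulr1 ler_pM.
  by rewrite sumr_const card_ord -[leLHS]mulr_natl mulrA.
have {Hv} [v Hv] := boolp.choice Hv.
exists (\matrix_(i, j) v j i 0); split; first by move/eqP; rewrite (negPf x0).
split=> [|i|i j]; [|by rewrite mxE; case: (Hv i)|by rewrite mxE; case: (Hv j)].
apply/matrixP => i j; rewrite mul_mx_diag !mxE mulrC.
have [/matrixP/(_ i 0) + _ _] := Hv j; rewrite !mxE => <-.
by apply: eq_bigr => k _; rewrite mxE.
Unshelve. all: by end_near. Qed.

(** The rescaled error is kept with its full expansion, not just as a bounded function, because it
    feeds the expansion of the eigenvectors. *)
Lemma remainder : exists2 F : R -> 'M[C]_m, mx_expands F &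
  \forall x \near (0 : R), forall i j, B x i j = mu i x *+ (i == j) + x%:C ^+ n.+1 * F x i j.
Proof.
have H (p : 'I_m * 'I_m) : exists g, expands g /\ \forall x \near (0 : R),
    B x p.1 p.2 = mu p.1 x *+ (p.1 == p.2) + x%:C ^+ n.+1 * g x.
  have O1 : isO n.+1 (fun x => B x p.1 p.2 - mu p.1 x *+ (p.1 == p.2)).
    by apply: isO_ext (B_lead p.1 p.2) => x; rewrite mxE [in X in _ + X]mxE diag_part_entry.
  have F1 : expands (fun x => B x p.1 p.2 - mu p.1 x *+ (p.1 == p.2)).
    move=> N; apply: expands_to_D; first exact: B_expands.
    apply: expands_to_N; apply: expands_to_ext (expands_poly (leading_poly p.1 *+ (p.1 ==
      p.2)) N) => x.
    by rewrite hornerMn.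
  have [g Fg Hg] := expands_div F1 O1; exists g; split=> //.
  by apply: filterS Hg => x <-; rewrite addrC subrK.
have {H} [g Hg] := boolp.choice H.
exists (fun x => \matrix_(i, j) g (i, j) x).
  by move=> i j N; apply: expands_to_ext ((Hg (i, j)).1 N) => x; rewrite mxE.
have := near0_forall (fun p => (Hg p).2); apply: filterS => x Hx i j.
by rewrite mxE; exact: (Hx (i, j)).
Qed.

(* With mu_i - mu_j = x^d (q + x r), q != 0, d <= n, the eigenvector equation reads
   v_j = q^-1 x (x^(n-d) ((F v)_j - (F v)_i v_j) - r v_j): the factor x on the right
   improves an expansion of v by one order. *)
Lemma eigenvectors_mx_expands (lam : 'I_m -> R -> C) (V : R -> 'M[C]_m) :
  V 0 = 1%:M ->
  (\forall x \near (0 : R),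
    [/\ B x *m V x = V x *m diag_mx (\row_i lam i x), forall i, V x i i = 1
      & forall i j, `|V x i j| <= 1]) ->
  mx_expands V.
Proof.
move=> V0 HV; have [F FF BF] := remainder.
(* All entries advance together, as the equation for one entry involves its whole column. The base
   case is |V_ji| <= 1. *)
move=> j i N; elim: N i j => [|N IH] i j.
  apply: expands_to0; exists 1 => //; apply: filterS HV => x [_ _ +].
  by move=> /(_ j i); rewrite expr0 mulr1.
have [->|ij] := eqVneq i j.
  by apply: expands_to_near (expands_cst 1 N.+1); apply: filterS HV => x [_ -> _].
have [sp [k pk]] := leading_poly_diff ij.
have [d [q [r [dn q0 pE]]]] := poly_lowest_term sp pk.
have FV l : expands_to N (fun x => \sum_k F x l k * V x k i).
  by apply: expands_to_sum => l' _; apply: expands_to_M; [exact: FF|exact: IH].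
apply: expands_to_near (expands_to_M (expands_cst q^-1 _) (expands_to_mulX (expands_to_D
  (expands_to_M (expandsX (n - d) N) (expands_to_D (FV j)
    (expands_to_N (expands_to_M (FV i) (IH i j)))))
  (expands_to_N (expands_to_M (expands_poly r N) (IH i j)))))).
(* The division by x^d says nothing at 0, where both sides vanish because V(0) = 1. *)
near=> x; have [->|x0] := eqVneq x 0.
  by rewrite raddf0 mul0r mulr0 V0 mxE eq_sym (negPf ij).
have [BV Vd _] : [/\ B x *m V x = V x *m diag_mx (\row_i lam i x), forall i, V x i i = 1
      & forall i j, `|V x i j| <= 1] by near: x.
have BFx : forall i j, B x i j = mu i x *+ (i == j) + x%:C ^+ n.+1 * F x i j by near: x.
have row l : mu l x * V x l i + x%:C ^+ n.+1 * (\sum_k F x l k * V x k i) = lam i x * V x l i.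
  have /matrixP/(_ l i) := BV; rewrite mul_mx_diag !mxE [RHS]mulrC => <-.
  rewrite mulr_sumr [RHS](eq_bigr (fun k =>
    mu l x *+ (l == k) * V x k i + x%:C ^+ n.+1 * (F x l k * V x k i))).
    rewrite big_split /=; congr (_ + _); rewrite (bigD1 l) //= eqxx big1 ?addr0 // => l' ll'.
    by rewrite eq_sym (negPf ll') mulr0n mul0r.
  by move=> l' _; rewrite BFx mulrDl mulrA.
(* With V_ii = 1, row i reads lambda_i = mu_i + x^(n+1) Fi. This eliminates lambda_i, of which no
   expansion is known, from row j. *)
have ri := row i; rewrite Vd !mulr1 in ri; have rj := row j.
set Fi := \sum_k F x i k * _ in ri *; set Fj := \sum_k F x j k * _ in rj *.
have xd0 : x%:C ^+ d != 0 by rewrite expf_neq0// fmorph_eq0.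
have E : (q + r.[x%:C] * x%:C) * V x j i = x%:C * x%:C ^+ (n - d) * (Fj - Fi * V x j i).
  apply: (mulIf xd0).
  have -> : (q + r.[x%:C] * x%:C) * V x j i * x%:C ^+ d = (mu i x - mu j x) * V x j i.
    have -> : mu i x - mu j x = (leading_poly i - leading_poly j).[x%:C] by rewrite
      hornerD hornerN.
    by rewrite pE hornerM hornerXn hornerD hornerMX hornerC; ring.
  have -> : x%:C * x%:C ^+ (n - d) * (Fj - Fi * V x j i) * x%:C ^+ d =
    x%:C ^+ n.+1 * (Fj - Fi * V x j i).
    by rewrite exprS -{2}(subnK dn) exprD; ring.
  rewrite mulrBl mulrBr -[mu i x](addrK (x%:C ^+ n.+1 * Fi)) ri.
  by rewrite mulrBl -rj; ring.
apply: (mulfI q0); rewrite mulVKf//.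
have -> : q * V x j i = (q + r.[x%:C] * x%:C) * V x j i - r.[x%:C] * x%:C * V x j i by ring.
by rewrite E; ring.
Unshelve. all: by end_near. Qed.

End Spectrum.

(** * Continuity of the eigenvalues *)

Section Continuity.
Context {R : realType}.
Local Notation C := R[i].
Local Notation cont_at r f := {for r, continuous (f : R -> R[i]^o)}.

Lemma continuous_atP (r : R) (f : R -> C) :
  cont_at r f <-> forall e : C, 0 < e -> \forall x \near r, `|f r - f x| <= e.
Proof. by split=> [/cvgrPdist_le|H]; [|apply/cvgrPdist_le]. Qed.

Lemma continuous_real_complex (r : R) : cont_at r (fun x => x%:C).
Proof.
apply/continuous_atP => e e0; have er : e \is Num.real by rewrite gtr0_real.
have [d de] := complex_realP _ er; rewrite de ltcR in e0 *.
apply/nbhs_ballP; exists d => //= x; rewrite /ball /= -rmorphB normC_real lecR.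
exact: ltW.
Qed.

Lemma continuous_at_cst (r : R) (a : C) : cont_at r (fun=> a).
Proof. exact: cst_continuous. Qed.

Lemma continuous_atM (r : R) (f g : R -> C) :
  cont_at r f -> cont_at r g -> cont_at r (fun x => f x * g x).
Proof. by move=> cf cg; exact: (@continuousM _ _ f g r cf cg). Qed.

Lemma continuous_atB (r : R) (f g : R -> C) :
  cont_at r f -> cont_at r g -> cont_at r (fun x => f x - g x).
Proof. by move=> cf cg; exact: (cvgB cf cg). Qed.

Lemma continuous_at_sum (r : R) (I : Type) (s : seq I) (P : pred I) (F : I -> R -> C) :
  (forall i, cont_at r (F i)) -> cont_at r (fun x => \sum_(i <- s | P i) F i x).
Proof.
move=> HF; elim: s => [|i s IH].
  have -> : (fun x => \sum_(i <- [::] | P i) F i x) = (fun=> 0).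
    by apply/funext => x; rewrite big_nil.
  exact: cst_continuous.
case Pi: (P i).
  have -> : (fun x => \sum_(i <- i :: s | P i) F i x) = (fun x =>
    F i x + \sum_(i <- s | P i) F i x).
    by apply/funext => x; rewrite big_cons Pi.
  exact: continuousD (HF i) IH.
have -> // : (fun x => \sum_(i <- i :: s | P i) F i x) = (fun x => \sum_(i <- s | P i) F i x).
by apply/funext => x; rewrite big_cons Pi.
Qed.

Lemma continuous_at_prod (r : R) (I : Type) (s : seq I) (P : pred I) (F : I -> R -> C) :
  (forall i, cont_at r (F i)) -> cont_at r (fun x => \prod_(i <- s | P i) F i x).
Proof.
move=> HF; elim: s => [|i s IH].
  have -> : (fun x => \prod_(i <- [::] | P i) F i x) = (fun=> 1).
    by apply/funext => x; rewrite big_nil.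
  exact: cst_continuous.
case Pi: (P i).
  have -> : (fun x => \prod_(i <- i :: s | P i) F i x) = (fun x =>
    F i x * \prod_(i <- s | P i) F i x).
    by apply/funext => x; rewrite big_cons Pi.
  exact: continuous_atM (HF i) IH.
have -> // : (fun x => \prod_(i <- i :: s | P i) F i x) = (fun x => \prod_(i <- s | P i) F i x).
by apply/funext => x; rewrite big_cons Pi.
Qed.

Lemma continuous_horner (r : R) (p : {poly C}) : cont_at r (fun x => p.[x%:C]).
Proof.
have -> : (fun x => p.[x%:C]) = (fun x : R => \sum_(i < size p) p`_i * \prod_(j < i) x%:C).
  apply/funext => x; rewrite horner_coef; apply: eq_bigr => i _.
  by rewrite prodr_const card_ord.
apply: continuous_at_sum => i.
apply: continuous_atM; first exact: continuous_at_cst.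
by apply: continuous_at_prod => j; exact: continuous_real_complex.
Qed.

Lemma continuous_det m (r : R) (F : R -> 'M[C]_m) :
  (forall i j, cont_at r (fun x => F x i j)) -> cont_at r (fun x => \det (F x)).
Proof.
move=> HF; apply: continuous_at_sum => s.
apply: continuous_atM; first exact: continuous_at_cst.
by apply: continuous_at_prod => i; exact: HF.
Qed.

Lemma horner_char_poly m (M : 'M[C]_m) z : (char_poly M).[z] = \det (z%:M - M).
Proof.
rewrite -[LHS]/(horner_eval z _) -det_map_mx; congr (\det _).
apply/matrixP => i j; rewrite !mxE /= horner_evalE hornerD hornerN hornerC.
by rewrite hornerMn hornerX.
Qed.

Lemma continuous_char_poly m (A : R -> 'M[C]_m) (z : C) (r : R) :
  continuous (A : R -> 'M[R[i]^o]_m) -> cont_at r (fun x => (char_poly (A x)).[z]).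
Proof.
move=> Ac; have -> : (fun x => (char_poly (A x)).[z]) = (fun x => \det (z%:M - A x)).
  by apply/funext => x; rewrite horner_char_poly.
apply: continuous_det => i j.
have -> : (fun x => (z%:M - A x) i j) = (fun x => (z%:M : 'M_m) i j - A x i j).
  by apply/funext => x; rewrite !mxE.
have cA : cont_at r (fun x => A x i j).
  exact: (@continuous_comp _ _ _ (A : R -> 'M[R[i]^o]_m) (fun M : 'M[R[i]^o]_m => M i j) r
    (Ac r) (@coord_continuous _ _ _ i j _)).
by apply: continuous_atB; [exact: continuous_at_cst|exact: cA].
Qed.

Lemma isO_continuous0 (f : R -> C) : isO 1 (fun x => f x - f 0) -> cont_at 0 f.
Proof.
move=> Of; apply/continuous_atP => e e0; have := isO_near_small e0 Of.
by apply: filterS => x; rewrite expr0 mulr1 distrC.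
Qed.

(** The characteristic polynomial of A(x) at the fixed point lambda_i(r) tends to 0 as x tends to r.
    It factors as lambda_i(r) - lambda_i(x) times factors of modulus at least h, so the first factor
    tends to 0. *)
Lemma continuous_simple_root m (A : R -> 'M[C]_m) (lam : 'I_m -> R -> C) (r : R) i (h : C) :
  continuous (A : R -> 'M[R[i]^o]_m) -> 0 < h ->
  (\forall x \near r, char_poly (A x) = \prod_k ('X - (lam k x)%:P)) ->
  (\forall x \near r, forall k, k != i -> h <= `|lam i r - lam k x|) ->
  cont_at r (lam i).
Proof.
move=> Ac h0 cA sep; apply/continuous_atP => e e0.
pose P x := (char_poly (A x)).[lam i r].
have PE x : char_poly (A x) = \prod_k ('X - (lam k x)%:P) ->
    P x = (lam i r - lam i x) * \prod_(k | k != i) (lam i r - lam k x).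
  move=> cAx; rewrite /P cAx horner_prod (bigD1 i) //= hornerXsubC; congr (_ * _).
  by apply: eq_bigr => k _; rewrite hornerXsubC.
have Pr : P r = 0 by rewrite PE ?subrr ?mul0r //; exact: nbhs_singleton cA.
pose H := \prod_(k | k != i) h; have H0 : 0 < H by apply: prodr_gt0.
have /continuous_atP cP : cont_at r P by exact: continuous_char_poly.
have := cP _ (mulr_gt0 e0 H0); rewrite Pr => cP0.
near=> x.
have Px : `|0 - P x| <= e * H by near: x.
have cAx : char_poly (A x) = \prod_k ('X - (lam k x)%:P) by near: x.
have sepx : forall k, k != i -> h <= `|lam i r - lam k x| by near: x.
rewrite -(ler_pM2r H0); apply: le_trans Px.
rewrite sub0r normrN PE // normrM ler_wpM2l // normr_prod.
by apply: ler_prod => k ki; rewrite sepx // ltW.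
Unshelve. all: by end_near. Qed.

Lemma continuous_labels m (A : R -> 'M[C]_m) (lam : 'I_m -> R -> C)
    (p : 'I_m -> {poly C}) (c : C) n :
  continuous (A : R -> 'M[R[i]^o]_m) -> 0 <= c ->
  (\forall x \near (0 : R), char_poly (A x) = \prod_k ('X - (lam k x)%:P)) ->
  (\forall x \near (0 : R), forall k, `|lam k x - (p k).[x%:C]| <= c * `|x%:C| ^+ n.+1) ->
  (forall K : C, 0 <= K -> \forall x \near (0 : R), x != 0 -> forall j k, j != k ->
     K * `|x%:C| ^+ n.+1 < `|(p j).[x%:C] - (p k).[x%:C]|) ->
  \forall r \near (0 : R), forall i, cont_at r (lam i).
Proof.
move=> Ac c0 cA lamp gap.
pose c1 := c + 1; have c10 : 0 < c1 by rewrite ltr_wpDl.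
(* Five units h = c1 |r|^(n+1) of gap: one for lambda_i - p_i at r, two for lambda_k - p_k at x,
   where |x|^(n+1) <= 2|r|^(n+1), one for moving p_k from r to x, and one left as separation. *)
have K0 : 0 <= c1 *+ 5 by rewrite mulrn_wge0 // ltW.
have gap5 := gap _ K0.
(* Continuity at r needs the properties on a neighbourhood of r, for every r close to 0. *)
have cA' := near_join cA; have lamp' := near_join lamp.
near=> r => i.
have cAr : \forall x \near r, char_poly (A x) = \prod_k ('X - (lam k x)%:P) by near: r.
have lampr : \forall x \near r, forall k, `|lam k x - (p k).[x%:C]| <= c * `|x%:C| ^+ n.+1.
  by near: r.
have lamr := nbhs_singleton lampr.
have [r0|r0] := eqVneq r 0.
  (* At 0 the gap gives no separation; lambda_i inherits continuity from p_i through the O(x^(n+1))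
     bound. *)
  rewrite r0; apply: isO_continuous0.
  have O1 : isO 1 (fun x => lam i x - (p i).[x%:C]).
    apply: (@isO_le _ 1 n.+1) => //; exists c => //.
    by apply: filterS lamp => x; exact.
  have := expands_small (expands_poly (p i)); rewrite /= => O2.
  have E0 : lam i 0 = (p i).[0%:C].
    by have := isO_at0 O1 => /eqP; rewrite subr_eq0 => /eqP.
  by apply: isO_ext (isOD O1 O2) => x; rewrite E0; ring.
pose h := c1 * `|r%:C| ^+ n.+1.
have nr0 : 0 < `|r%:C| ^+ n.+1 by rewrite exprn_gt0 // normr_gt0 fmorph_eq0.
have h0 : 0 < h by rewrite mulr_gt0.
have gapr j k : j != k -> h *+ 5 < `|(p j).[r%:C] - (p k).[r%:C]|.
  move=> jk; rewrite -mulrnAl; move: j k jk; have : r != 0 by []; by near: r.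
apply: (continuous_simple_root Ac h0 cAr).
have cX : \forall x \near r, `|r%:C ^+ n.+1 - x%:C ^+ n.+1| <= `|r%:C| ^+ n.+1.
  have /continuous_atP/(_ _ nr0) : cont_at r (fun x => ('X^(n.+1) : {poly C}).[x%:C]).
    exact: continuous_horner.
  by apply: filterS => x; rewrite !hornerXn.
have cp : \forall x \near r, forall k, `|(p k).[r%:C] - (p k).[x%:C]| <= h.
  apply: (filter_forall (nbhs_filter r)) => k.
  have /continuous_atP/(_ _ h0) // : cont_at r (fun x => (p k).[x%:C]).
  exact: continuous_horner.
move: cX cp lampr; apply: filterS3 => x X Pk Lx k ki.
have cc1 : c <= c1 by rewrite lerDl.
have X2 : `|x%:C| ^+ n.+1 <= `|r%:C| ^+ n.+1 *+ 2.
  have -> : `|x%:C| ^+ n.+1 = `|r%:C ^+ n.+1 - (r%:C ^+ n.+1 - x%:C ^+ n.+1)|.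
    by rewrite -normrX; congr `|_|; ring.
  by rewrite (le_trans (ler_normB _ _)) // normrX mulr2n lerD.
have Lx2 : `|lam k x - (p k).[x%:C]| <= h *+ 2.
  rewrite (le_trans (Lx k)) // -mulrnAr.
  by apply: ler_pM; [exact: c0|exact: exprn_ge0|exact: cc1|exact: X2].
have Lr : `|lam i r - (p i).[r%:C]| <= h.
  by rewrite (le_trans (lamr i)) // ler_wpM2r // ltW.
rewrite eq_sym in ki; have G := ltW (gapr _ _ ki).
have E : (p i).[r%:C] - (p k).[r%:C] = (lam i r - lam k x)
    - (lam i r - (p i).[r%:C]) + (lam k x - (p k).[x%:C]) - ((p k).[r%:C] - (p k).[x%:C])
      by ring.
have {}G : h *+ 5 <= `|lam i r - lam k x| + h + h *+ 2 + h.
  apply: le_trans G _; rewrite E.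
  rewrite (le_trans (ler_normB _ _)) // lerD //.
  rewrite (le_trans (ler_normD _ _)) // lerD //.
  by rewrite (le_trans (ler_normB _ _)) // lerD.
rewrite [leLHS](_ : _ = h *+ 5 - h *+ 4); last by ring.
rewrite lerBlDr; apply: le_trans G _.
by rewrite [leLHS](_ : _ = `|lam i r - lam k x| + h *+ 4) //; ring.
Unshelve. all: by end_near. Qed.

End Continuity.

Theorem theorem2p5 (R : realType) (m : nat) (A : R -> 'M[R[i]]_m)
    (Ac : nat -> 'M[R[i]]_m) (n : nat) :
  (2 <= m)%N ->
  continuous (A : R -> 'M[R[i]^o]_m) ->
  full_expansion A Ac ->
  nondegenerate_of_order A (Ac 0%N) n ->
  (exists (M : R -> 'M[R[i]]_m) (Mc : nat -> 'M[R[i]]_m)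
          (Lambda : R -> 'rV[R[i]]_m),
     [/\ \forall rho \near (0 : R), M rho \in unitmx,
         bounded_near M (nbhs (0 : R)),
         bounded_near (fun rho => invmx (M rho)) (nbhs (0 : R)),
         full_expansion M Mc
       & forall N : nat,
           bigO_pow
             (fun rho => A rho *m M rho - M rho *m diag_mx (Lambda rho)) N]) /\
  (exists lam : 'I_m -> R -> R[i],
     [/\ \forall rho \near (0 : R), forall i : 'I_m,
           {for rho, continuous (lam i : R -> R[i]^o)},
         \forall rho \near (0 : R),
           char_poly (A rho) = \prod_(i < m) ('X - (lam i rho)%:P)
       & exists i j : 'I_m,
           i != j /\ bigO_pow (fun rho => lam i rho - lam j rho : R[i]^o) n]).
Proof.
move=> m2 A_cont FA [d [assA nd min]].
have [eg [T [B [[FT T0] [FB OB] AT eg_d eg_sep]]]] := normal_form FA assA nd.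
have [lam [c [c0 Hlam]]] := eigenvalue_labels OB.
have [V [V0 HV]] := labelled_eigenvectors eg_sep c0 Hlam.
have FV := eigenvectors_mx_expands eg_sep FB OB V0 HV.
have Tu := near_unitmx FT T0.
have cA : \forall x \near (0 : R), char_poly (A x) = \prod_i ('X - (lam i x)%:P).
  near=> x; have [<- _] : char_poly (B x) = \prod_i ('X - (lam i x)%:P) /\ True.
    split=> //; near: x; apply: filterS Hlam => x [? _] //.
  apply/esym; apply: (@char_poly_similar _ _ (T x)); first by near: x.
  by apply/esym; near: x.
have lam_lead : \forall x \near (0 : R), forall i,
    `|lam i x - (leading_poly (eg := eg) (n := n) i).[x%:C]| <= c * `|x%:C| ^+ n.+1.
  by apply: filterS Hlam => x [_ [? _]].
split.
  pose M x := T x *m V x; have FM : mx_expands M by exact: mx_expands_M.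
  have M0 : M 0 \in unitmx by rewrite /M V0 mulmx1.
  have [Mc HMc] := mx_expands_full_expansion FM.
  exists M, Mc, (fun x => \row_i lam i x); split=> //.
  - exact: near_unitmx.
  - exact/bounded_nearP/mx_expands_mO0.
  - exact/bounded_nearP/mx_expands_mO0/mx_expands_inv.
  move=> N; apply/matrix_bigO_powP; apply: (@mx_isO_near _ _ N (fun=> 0)).
    near=> x; have ATx : A x *m T x = T x *m B x by near: x.
    have [BV _ _] : [/\ B x *m V x = V x *m diag_mx (\row_i lam i x), forall i, V x i i = 1
      & forall i j, `|V x i j| <= 1] by near: x.
    by rewrite /M mulmxA ATx -mulmxA BV !mulmxA subrr.
  by move=> i j; apply: isO_ext (isO0 N) => x; rewrite mxE.
exists lam; split=> //.
  by apply: (continuous_labels A_cont c0 cA lam_lead) => K K0; exact: leading_gap.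
have [i [j [ij pij]]] : exists i j : 'I_m, i != j /\ part d n i j.
  case: n assA nd min {eg_d eg_sep OB Hlam lam_lead} => [|n] assA nd min.
    (* For n = 0 the partition is trivial, and m >= 2 provides two distinct indices in its only
       class. *)
    exists (Ordinal (ltnW m2)), (Ordinal m2); split=> //.
    by apply/partP.
  have assAn : assumption_A A (Ac 0%N) d n.
    by case: assA => sch dia; split=> k kn; [apply: sch|apply: dia]; exact: leqW.
  apply: (coinciding_pair assA) => ndn.
  exact: (min n (ltnSn n) (conj assAn ndn)).
exists i, j; split=> //; apply/scalar_bigO_powP.
pose mu k : {poly R[i]} := leading_poly (eg := eg) (n := n) k.
have Ol k : isO n (fun x => lam k x - (mu k).[x%:C]).
  by apply: (@isO_le _ n n.+1) => //; exists c => //; apply: filterS lam_lead.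
have Omu : isO n (fun x => (mu i).[x%:C] - (mu j).[x%:C]).
  apply: isO_ext (isOMl (isO_cst (eg n 0 i - eg n 0 j)) (isOX n)) => x.
  rewrite !horner_poly -sumrB big_ord_recr /= big1 ?add0r => [|k _]; first by rewrite mulrBl.
  by rewrite eg_d // (partP _ _ _ _ pij) ?subrr.
apply: isO_ext (isOB (isOD (Ol i) Omu) (Ol j)) => x; ring.
Unshelve. all: by end_near. Qed.
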